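(* Let $d\geq 2$, let $t\in\mathbb N$, and let $(X,\lambda)$ be a weighted $t$-design set on $S^{d-1}$ of even size $|X|$. Then the pair $(\alpha_{X,\lambda},w_{X,\lambda})$ constructed from $(X,\lambda)$ as in the context is a weighted $t$-design curve on $S^d$.
   Context: $\mathbb N=\{0,1,\dots\}$. $S^d\subset\mathbb R^{d+1}$ is the unit sphere. $P_t(S^d)$ is the space of restrictions to $S^d$ of real-valued polynomials on $\mathbb R^{d+1}$ of degree at most $t$. $\sigma$ is the uniform measure on the sphere, normalized to have total mass $1$. A weighted $t$-design set on $S^{d}$ is a pair $(X,\lambda)$ of a finite subset $X\subset S^{d}$ and a function $\lambda:X\to\mathbb R\setminus\{0\}$ such that $\sum_{x\in X}f(x)\lambda(x)=\int_{S^{d}}f\,d\sigma$ for all $f\in P_t(S^{d})$. For a continuous, piecewise smooth, closed curve $\gamma:[0,1]\to S^d$ with finitely many self-intersections and a function $w:[0,1]\to\mathbb R$, the pair $(\gamma,w)$ is a weighted $t$-design curve on $S^d$ if $\int_0^1f(\gamma(s))w(s)|\gamma'(s)|\,ds=\int_{S^d}f\,d\sigma$ for all $f\in P_t(S^d)$. Convention: a pair $(\gamma,w)$ for which the speed $|\gamma'|$ is unbounded is also called a weighted $t$-design curve if it can be reparameterized to produce a weighted $t$-design curve in this sense. Construction. Let $(X,\lambda)$ be a weighted $t$-design set on $S^{d-1}$ with $|X|=2N$ even, and enumerate $X=\{x_i\}_{i=1}^{2N}$. Put $\Lambda_0:=0$ and $$\Lambda_i:=\frac{\sum_{j=1}^i|\lambda(x_j)|}{\sum_{j=1}^{2N}|\lambda(x_j)|}\quad(i\in\{1,\dots,2N\}).$$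 For $s\in[\Lambda_{i-1},\Lambda_i]$ set $$\alpha_\lambda(s):=(-1)^{i-1}\left(2\frac{s-\Lambda_{i-1}}{\Lambda_i-\Lambda_{i-1}}-1\right),\quad \alpha_X(s):=\sqrt{1-\alpha_\lambda(s)^2}\,x_i,\quad l(s):=\frac{\lambda(x_i)}{\Lambda_i-\Lambda_{i-1}}$$ (the value of $l$ at the finitely many breakpoints $\Lambda_i$ is immaterial). Let $c$ be the quotient of the volume of $S^{d-1}$ by the volume of $S^d$ (each with its standard measure). Then $$\alpha_{X,\lambda}:=(\alpha_X,\alpha_\lambda):[0,1]\to S^d,\qquad w_{X,\lambda}:=\frac{2c\,l\,(1-\alpha_\lambda^2)^{\frac{d-2}{2}}}{|\alpha_{X,\lambda}'|}:[0,1]\to\mathbb R.$$ *)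

(* Defs.v *)
From HB Require Import structures.
From mathcomp Require Import all_boot all_order all_algebra finmap.
(* The notations of mpoly clash with those of MathComp-Analysis. *)
From mathcomp Require Import (canonicals, coercions) mpoly.
From mathcomp Require Import all_classical all_reals all_analysis.
From mathcomp Require Import measurable_realfun.

Set Implicit Arguments.
Unset Strict Implicit.
Unset Printing Implicit Defensive.

Import Order.TTheory GRing.Theory Num.Theory.
Import numFieldNormedType.Exports.

Local Open Scope classical_set_scope.
Local Open Scope ring_scope.

(* R^n is n.-tuple R with its product sigma-algebra, which is the Borel one. *)

Section LebesgueTuple.
Variable R : realType.

Definition cons_pair n (p : R * n.-tuple R) : n.+1.-tuple R :=
  [tuple of p.1 :: p.2].

Definition uncons_pair n (v : n.+1.-tuple R) : R * n.-tuple R :=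
  (thead v, [tuple of behead v]).

Lemma cons_pairK n : cancel (@cons_pair n) (@uncons_pair n).
Proof. by move=> [a v]; congr pair; apply/val_inj. Qed.

Lemma measurable_cons_pair n : measurable_fun setT (@cons_pair n).
Proof. exact: measurable_cons. Qed.

Lemma measurable_uncons_pair n : measurable_fun setT (@uncons_pair n).
Proof.
apply/measurable_fun_pairP; split; last exact: measurable_behead.
exact: measurable_tnth.
Qed.

Section Cons.
Variables (n : nat) (mu : {sigma_finite_measure set (n.-tuple R) -> \bar R}).

Definition lebesgue_cons : set (n.+1.-tuple R) -> \bar R :=
  pushforward (@lebesgue_measure R \x mu)%E (@cons_pair n).

HB.instance Definition _ := Measure.copy lebesgue_cons
  (measure_function_pushforward__canonical__measure_function_Measure
     (@lebesgue_measure R \x mu)%E (@measurable_cons_pair n)).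

Lemma sigma_finite_lebesgue_cons : sigma_finite setT lebesgue_cons.
Proof.
have /sigma_finiteP[F [TF ndF Foo]] := sigma_finiteT (@lebesgue_measure R).
have /sigma_finiteP[G [TG ndG Goo]] := sigma_finiteT mu.
exists (fun k => @uncons_pair n @^-1` (F k `*` G k)).
  rewrite -preimage_bigcup [X in _ @^-1` X](_ : _ = setT) ?preimage_setT//.
  apply/seteqP; split=> // -[x y] _.
  have [i _ Fix] : (\bigcup_i F i) x by rewrite -TF.
  have [j _ Gjy] : (\bigcup_i G i) y by rewrite -TG.
  exists (maxn i j) => //; split => /=.
  - by move: x Fix; exact/subsetPset/ndF/leq_maxl.
  - by move: y Gjy; exact/subsetPset/ndG/leq_maxr.
move=> k; have [mFk Fkoo] := Foo k; have [mGk Gkoo] := Goo k; split.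
  rewrite -[X in measurable X]setTI.
  by apply: measurable_uncons_pair => //; exact: measurableX.
rewrite /lebesgue_cons /pushforward -comp_preimage.
rewrite (_ : _ \o _ = id); last by apply/funext => p; exact: cons_pairK.
by rewrite preimage_id product_measure1E// lte_mul_pinfty// ge0_fin_numE.
Qed.

HB.instance Definition _ := Measure_isSigmaFinite.Build _ _ _ lebesgue_cons
  sigma_finite_lebesgue_cons.

End Cons.

Fixpoint lebesgue_tuple n : {sigma_finite_measure set (n.-tuple R) -> \bar R} :=
  match n with
  | 0 => \d_([tuple] : 0.-tuple R)
  | n'.+1 => lebesgue_cons (lebesgue_tuple n')
  end.

End LebesgueTuple.

Section Sphere.
Variable R : realType.
Implicit Types n t : nat.

Definition enorm n (x : n.-tuple R) : R :=
  Num.sqrt (\sum_(i < n) tnth x i ^+ 2).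

(* sphere n is the unit sphere of R^n, i.e. S^(n-1). *)
Definition sphere n : set (n.-tuple R) := [set x | enorm x = 1].

Definition unit_ball n : set (n.-tuple R) := [set x | enorm x <= 1].

Definition radial n (x : n.-tuple R) : n.-tuple R :=
  [tuple tnth x i / enorm x | i < n].

Lemma measurable_enorm n : measurable_fun setT (@enorm n).
Proof.
apply: (@measurableT_comp _ _ _ _ _ _ (@Num.sqrt R)).
  by apply: continuous_measurable_fun => y; exact: sqrt_continuous.
apply: measurable_sum => i.
by apply: measurable_funX; exact: measurable_tnth.
Qed.

Lemma measurable_unit_ball n : measurable (@unit_ball n).
Proof.
rewrite (_ : @unit_ball n = setT `&` @enorm n @^-1` `]-oo, 1%R]).
  by apply: measurable_enorm => //; exact: measurable_itv.
by rewrite setTI; apply/seteqP; split=> x /=; rewrite in_itv.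
Qed.

Lemma measurable_radial n : measurable_fun setT (@radial n).
Proof.
apply/measurable_fun_tnthP => i.
rewrite (_ : _ \o _ = (fun x => tnth x i) \* (fun x => enorm x `^ (-1))).
  apply: measurable_funM; first exact: measurable_tnth.
  apply: (@measurableT_comp _ _ _ _ _ _ (@powR R ^~ (-1))).
    exact: measurable_powR.
  exact: measurable_enorm.
by apply/funext => x /=; rewrite tnth_mktuple powR_inv1// sqrtr_ge0.
Qed.

Definition cone_measure n : set (n.-tuple R) -> \bar R :=
  pushforward (mrestr (lebesgue_tuple R n) (@measurable_unit_ball n))
    (@radial n).

HB.instance Definition _ n := Measure.copy (@cone_measure n)
  (measure_function_pushforward__canonical__measure_function_Measure
     (mrestr (lebesgue_tuple R n) (@measurable_unit_ball n))
     (@measurable_radial n)).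

(* Standard surface measure, from polar coordinates: a part A of the sphere of
   R^n gets n times the Lebesgue measure of { r x | 0 < r <= 1, x in A }. *)
Definition surface_measure n : set (n.-tuple R) -> \bar R :=
  mscale n%:R%:nng (@cone_measure n).

HB.instance Definition _ n := Measure.on (@surface_measure n).

Definition sphere_volume n : R := fine (surface_measure (@sphere n)).

Lemma sphere_volumeV_ge0 n : 0 <= (sphere_volume n)^-1.
Proof. by rewrite invr_ge0 fine_ge0. Qed.

Definition uniform_measure n : set (n.-tuple R) -> \bar R :=
  mscale (NngNum (sphere_volumeV_ge0 n)) (@surface_measure n).

HB.instance Definition _ n := Measure.on (@uniform_measure n).

(* Only the values of f on the sphere are constrained. *)
Definition sphere_poly n t (f : n.-tuple R -> R) : Prop :=
  exists2 p : mpoly.mpoly n R, (mpoly.msize p <= t.+1)%N &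
    {in @sphere n, forall x, f x = mpoly.meval (tnth x) p}.

Definition weighted_design_set n t (X : {fset n.-tuple R})
    (lam : n.-tuple R -> R) : Prop :=
  [/\ {in X, forall x, sphere x},
      {in X, forall x, lam x != 0} &
      forall f, sphere_poly t f ->
        (\sum_(x <- X) f x * lam x)%:E =
        (\int[@uniform_measure n]_(x in @sphere n) (f x)%:E)%E].

End Sphere.

Section Curve.
Variable R : realType.
Implicit Types (n t : nat) (w phi : R -> R).

Definition smooth (g : R -> R) : Prop := forall k (x : R), derivable (derive1n k g) x 1.

(* Smooth up to the end points on each closed interval of a subdivision. *)
Definition piecewise_smooth n (gamma : R -> n.-tuple R) : Prop :=
  exists2 s : seq R, itv_partition 0 1 s &
    forall i, (i < size s)%N -> forall j : 'I_n,
      exists2 g, smooth g &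
        {in `[nth 0 (0 :: s) i, nth 0 s i], forall u, tnth (gamma u) j = g u}.

Definition speed n (gamma : R -> n.-tuple R) (u : R) : R :=
  enorm [tuple derive1 (fun v => tnth (gamma v) i) u | i < n].

Definition self_intersections n (gamma : R -> n.-tuple R) : set (R * R) :=
  [set p | [/\ p.1 \in `[0, 1], p.2 \in `[0, 1],
               p.1 < p.2 & gamma p.1 = gamma p.2]].

(* The first clause of the definition of a weighted design curve; the maps are
   only considered on [0, 1]. *)
Definition regular_design_curve n t (gamma : R -> n.-tuple R) w : Prop :=
  [/\ {in `[0, 1], forall u, sphere (gamma u)} /\
      (forall i : 'I_n, {within `[0, 1], continuous (fun u => tnth (gamma u) i)}),
      piecewise_smooth gamma,
      gamma 0 = gamma 1,
      finite_set (self_intersections gamma) &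
      forall f, sphere_poly t f ->
        let F u := (f (gamma u) * w u * speed gamma u)%:E in
        (@lebesgue_measure R).-integrable `[0%R, 1%R] F /\
        (\int[@lebesgue_measure R]_(u in `[0%R, 1%R]) F u =
         \int[@uniform_measure R n]_(x in @sphere R n) (f x)%:E)%E].

Definition speed_unbounded n (gamma : R -> n.-tuple R) : Prop :=
  ~ exists M, {in `]0, 1[, forall u,
      (forall i : 'I_n, derivable (fun v => tnth (gamma v) i) u 1) ->
      speed gamma u <= M}.

(* An increasing homeomorphism of [0, 1] that is a diffeomorphism away from
   finitely many points. *)
Definition reparameterization phi : Prop :=
  [/\ phi 0 = 0, phi 1 = 1,
      {within `[0, 1], continuous phi},
      {in `[0, 1] &, {homo phi : u v / u < v}} &
      exists2 s : seq R, itv_partition 0 1 s &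
        forall i, (i < size s)%N ->
          {in `]nth 0 (0 :: s) i, nth 0 s i[, forall u,
            (forall k, derivable (derive1n k phi) u 1) /\ 0 < derive1 phi u}].

Definition weighted_design_curve n t (gamma : R -> n.-tuple R) w : Prop :=
  regular_design_curve t gamma w \/
  speed_unbounded gamma /\
  exists2 phi, reparameterization phi &
    regular_design_curve t (gamma \o phi) (w \o phi).

End Curve.

(* The points are numbered from 0, so piece i : 'I_m, which is
   [Lambda i, Lambda i.+1], corresponds to x_(i+1). *)
Section Construction.
Variables (R : realType) (d m : nat).
Variables (lam : d.-tuple R -> R) (x : 'I_m -> d.-tuple R).

Definition Lambda (i : nat) : R :=
  (\sum_(j < m | (j < i)%N) `|lam (x j)|) / \sum_(j < m) `|lam (x j)|.

(* At a breakpoint either adjacent piece may be picked: both give the same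
   point of the curve. *)
Definition piece (s : R) : option 'I_m :=
  [pick i : 'I_m | Lambda i <= s <= Lambda i.+1].

Definition alpha_lam (s : R) : R :=
  if piece s is Some i then
    (-1) ^+ i * (2 * ((s - Lambda i) / (Lambda i.+1 - Lambda i)) - 1)
  else 0.

Definition alpha_X (s : R) : d.-tuple R :=
  if piece s is Some i then
    [tuple Num.sqrt (1 - alpha_lam s ^+ 2) * tnth (x i) k | k < d]
  else [tuple 0 | k < d].

Definition ell (s : R) : R :=
  if piece s is Some i then lam (x i) / (Lambda i.+1 - Lambda i) else 0.

Definition volume_ratio : R := sphere_volume R d / sphere_volume R d.+1.

Definition alpha_X_lam (s : R) : d.+1.-tuple R :=
  [tuple of rcons (alpha_X s) (alpha_lam s)].

Definition w_X_lam (s : R) : R :=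
  2 * volume_ratio * ell s *
    (1 - alpha_lam s ^+ 2) `^ ((d%:R - 2) / 2) / speed alpha_X_lam s.

End Construction.

(* Main.v *)
(** The curve runs from pole to pole along the meridian through x_1, then back
    along the meridian through x_2, and so on. Its height is affine in the
    parameter, so its speed blows up at the poles; the substitution
    (1 - cos th) / 2 on each piece makes it a sequence of half great circles
    traversed at constant speed.  The weighted integral of f along the i-th one
    is then lambda(x_i) vol(S^(d-1)) / vol(S^d) times the integral over [0, pi]
    of f (x_i sin th, cos th) (sin th)^(d-1).

    It remains to slice the sphere.  For a monomial y^a z^k the integral over
    S^d factors as the integral of y^a over S^(d-1), computed by the design,
    times a beta-type integral in th.  This is obtained from balls: the surface
    measure being a cone measure, n * int_B g(x/|x|) = (n+m) * int_B g in R^n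
    for g homogeneous of degree m; slicing the ball gives
    int_0^pi cos^k sin^(q+1) with q = d + |a|, and integration by parts lowers
    the exponent q+1 to q-1, absorbing the factors n and n+m.  No polar
    coordinates are needed. *)

Require Import Defs.
From mathcomp Require Import all_boot all_order all_algebra finmap.
From mathcomp Require Import (canonicals, coercions) mpoly.
From mathcomp Require Import all_classical all_reals all_analysis.
From mathcomp Require Import measurable_realfun ring lra.

Set Implicit Arguments.
Unset Strict Implicit.
Unset Printing Implicit Defensive.

Import Order.TTheory GRing.Theory Num.Theory.
Import numFieldNormedType.Exports.

Local Open Scope classical_set_scope.
Local Open Scope ring_scope.

(** * Lebesgue measure on tuples *)

(** Balls enter because Tonelli applies to Lebesgue measure directly, while slicing the surface
    measure would need a disintegration. The slice of the unit ball at height z is again a ball, of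
    radius sqrt(1 - z^2), so a homogeneous integrand contributes a power of that radius. This is why
    polynomials are split into monomials: these are homogeneous in the horizontal variables and in
    the height separately, and deleting the last variable never raises the degree above t, so the
    design still applies. The weight may be negative: the pieces have width proportional to
    |lambda|, [ell] carries the sign, and the width of a piece times [ell] is exactly lambda(x_i).
    The factor 2 in the weight compensates the slope of the height, which is 2 / width up to sign,
    and division by the speed makes the weighted integral insensitive to the parameterization. Each
    piece is a half circle, with sin th >= 0, so even antipodal points of X give pieces that meet
    only at the poles; hence the self-intersections are finite in number. An even number of pieces
    is what closes the curve. *)

Section LebesgueTupleIntegral.
Variable R : realType.
Local Open Scope ereal_scope.
Local Notation mu := (@lebesgue_measure R).
Local Notation lt := (lebesgue_tuple R).

Lemma ge0_integral_lebesgue_cons n (f : n.+1.-tuple R -> \bar R) :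
  measurable_fun setT f -> (forall v, 0 <= f v) ->
  \int[lt n.+1]_v f v = \int[mu]_a \int[lt n]_v f [tuple of a :: v].
Proof.
move=> mf f0.
transitivity (\int[measure_function_pushforward__canonical__measure_function_Measure
    (mu \x lt n) (@measurable_cons_pair R n)]_v f v).
  by apply: eq_measure_integral => A mA _.
rewrite ge0_integral_pushforward//; last exact: measurable_cons_pair.
rewrite preimage_setT fubini_tonelli1//=.
exact: (measurableT_comp mf (@measurable_cons_pair R n)).
Qed.

Lemma measurable_rcons n : measurable_fun setT
  (fun p : n.-tuple R * R => [tuple of rcons p.1 p.2]).
Proof.
apply/measurable_fun_tnthP => i /=.
have [ilt|ige] := ltnP i n.
  rewrite (_ : _ \o _ = (fun p => tnth p.1 (Ordinal ilt))); last first.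
    apply/funext => p /=; rewrite (tnth_nth 0%R) /= nth_rcons size_tuple ilt.
    by rewrite (tnth_nth 0%R).
  by apply: (measurableT_comp (measurable_tnth _)).
rewrite (_ : _ \o _ = snd)//.
apply/funext => p /=; rewrite (tnth_nth 0%R) /= nth_rcons size_tuple.
have -> : nat_of_ord i = n by apply/eqP; rewrite eqn_leq ige -ltnS ltn_ord.
by rewrite ltnn eqxx.
Qed.

(** The measure is built by adding first coordinates, whereas the height is the last one. In the
    induction step Tonelli exchanges the first coordinate with the last. *)
Lemma ge0_integral_lebesgue_rcons n (f : n.+1.-tuple R -> \bar R) :
  measurable_fun setT f -> (forall v, 0 <= f v) ->
  \int[lt n.+1]_v f v = \int[mu]_z \int[lt n]_y f [tuple of rcons y z].
Proof.
elim: n f => [|n IH] f mf f0.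
  rewrite (ge0_integral_lebesgue_cons mf f0); apply: eq_integral => a _.
  apply: eq_integral => v _; congr f; apply/val_inj => /=.
  by rewrite (tuple0 v).
rewrite (ge0_integral_lebesgue_cons mf f0).
have mf3 : measurable_fun setT (fun p : (R * R) * n.-tuple R =>
    f [tuple of p.1.1 :: [tuple of rcons p.2 p.1.2]]).
  apply: (measurableT_comp mf); apply: measurable_cons.
    exact: measurableT_comp.
  rewrite (_ : (fun _ => _) = (fun p : n.-tuple R * R => [tuple of rcons p.1 p.2])
     \o (fun p : (R * R) * n.-tuple R => (p.2, p.1.2)))//.
  apply: (measurableT_comp (@measurable_rcons n)).
  apply/measurable_fun_pairP; split; first exact: measurable_snd.
  exact: (measurableT_comp measurable_snd measurable_fst).
transitivity (\int[mu]_a \int[mu]_z \int[lt n]_y f [tuple of a :: [tuple of rcons y z]]).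
  apply: eq_integral => a _; rewrite IH; [by []| |by move=> v; exact: f0].
  by apply: (measurableT_comp mf); exact: measurable_cons.
etransitivity.
  refine (@fubini_tonelli _ _ _ _ _ mu mu (fun p : R * R =>
    \int[lt n]_y f [tuple of p.1 :: [tuple of rcons y p.2]]) _ _).
  - exact: (measurable_fun_fubini_tonelli_F _ mf3).
  - by move=> p; apply: integral_ge0.
apply: eq_integral => z _; rewrite ge0_integral_lebesgue_cons; last by move=> ?; exact: f0.
  + apply: eq_integral => a _; apply: eq_integral => v _.
    by congr f; apply/val_inj.
  + apply: (measurableT_comp mf).
    rewrite (_ : (fun _ => _) = (fun p : n.+1.-tuple R * R => [tuple of rcons p.1 p.2])
     \o (fun y => (y, z)))//.
    apply: (measurableT_comp (@measurable_rcons _)).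
    by apply/measurable_fun_pairP; split; [exact: measurable_id|exact: measurable_cst].
Qed.

Definition scale_tuple n (r : R) (x : n.-tuple R) : n.-tuple R :=
  [tuple (r * tnth x i)%R | i < n].

Lemma measurable_scale_tuple n (r : R) : measurable_fun setT (@scale_tuple n r).
Proof.
apply/measurable_fun_tnthP => i.
rewrite (_ : _ \o _ = (fun x => r * tnth x i)%R).
  by apply: measurable_funM => //; exact: measurable_tnth.
by apply/funext => x /=; rewrite tnth_mktuple.
Qed.

(** Uniqueness of Lebesgue measure: [nu], which is r times the image of [mu] under scaling, has the
    right value on half-open intervals. *)
Lemma lebesgue_measure_scale (r : R) (A : set (measurableTypeR R)) :
  (0 < r)%R -> measurable A -> mu A = r%:E * mu ( *%R r @^-1` A).
Proof.
move=> r0 mA.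
have mr : measurable_fun setT ( *%R r : measurableTypeR R -> measurableTypeR R).
  by apply: measurable_funM.
pose nu : {measure set (measurableTypeR R) -> \bar R} :=
  mscale (NngNum (ltW r0)) (measure_function_pushforward__canonical__measure_function_Measure mu mr).
rewrite (@lebesgue_measure_unique R nu)// => X [[a b] /= _ <-].
rewrite /nu /= /mscale /= /pushforward.
rewrite (_ : _ @^-1` _ = `](a / r)%R, (b / r)%R]%classic); last first.
  apply/seteqP; split => y /=; rewrite !in_itv/=.
  - by rewrite ltr_pdivrMr// ler_pdivlMr// mulrC.
  - by rewrite ltr_pdivrMr// ler_pdivlMr// mulrC.
rewrite !lebesgue_measure_itv/= !lte_fin ltr_pM2r ?invr_gt0//.
case: ifPn => // _; last by rewrite mule0.
by rewrite -!EFinB -EFinM -mulrBl mulrCA divff ?gt_eqF// mulr1.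
Qed.

Lemma ge0_integral_scale (r : R) (f : R -> \bar R) : (0 < r)%R ->
  measurable_fun setT f -> (forall v, 0 <= f v) ->
  \int[mu]_x f x = r%:E * \int[mu]_x f (r * x)%R.
Proof.
move=> r0 mf f0.
have mr : measurable_fun setT ( *%R r : measurableTypeR R -> measurableTypeR R).
  by apply: measurable_funM.
pose nu : {measure set (measurableTypeR R) -> \bar R} :=
  (measure_function_pushforward__canonical__measure_function_Measure mu mr).
transitivity (\int[mscale (NngNum (ltW r0)) nu]_x f x).
  by apply: eq_measure_integral => A mA _; exact: lebesgue_measure_scale.
rewrite ge0_integral_mscale//=; congr (_ * _).
by rewrite /nu ge0_integral_pushforward//= preimage_setT.
Qed.

Lemma ge0_integral_scale_tuple n (r : R) (f : n.-tuple R -> \bar R) : (0 < r)%R ->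
  measurable_fun setT f -> (forall v, 0 <= f v) ->
  \int[lt n]_x f x = (r ^+ n)%:E * \int[lt n]_x f (scale_tuple r x).
Proof.
move=> r0; elim: n f => [|n IH] f mf f0.
  rewrite mul1e; apply: eq_integral => v _; congr f.
  by apply/val_inj; rewrite /= [val v](congr1 val (tuple0 v)); rewrite enum_ord0.
have mfs : measurable_fun setT (f \o @scale_tuple n.+1 r).
  by apply: (measurableT_comp mf); exact: measurable_scale_tuple.
have consE a (v : n.-tuple R) : scale_tuple r [tuple of a :: v] =
   [tuple of (r * a)%R :: scale_tuple r v].
  apply: eq_from_tnth => i; rewrite tnth_mktuple.
  case: (unliftP ord0 i) => [j ->|->]; rewrite ?tnthS ?tnth0//.
  by rewrite tnth_mktuple.
have mF : measurable_fun setT (fun p : R * n.-tuple R => f [tuple of p.1 :: p.2]).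
  by apply: (measurableT_comp mf); exact: measurable_cons.
rewrite (ge0_integral_lebesgue_cons mf f0).
rewrite (ge0_integral_lebesgue_cons mfs); last by move=> v; exact: f0.
rewrite (ge0_integral_scale r0); [|exact: (measurable_fun_fubini_tonelli_F _ mF)|by move=> v; apply: integral_ge0].
rewrite exprS EFinM -muleA; congr (_ * _).
rewrite -ge0_integralZl//=.
- apply: eq_integral => a _; rewrite IH//.
  + by congr (_ * _); apply: eq_integral => v _; rewrite consE.
  + by apply: (measurableT_comp mf); exact: measurable_cons.
- apply: (measurable_fun_fubini_tonelli_F (fun p : R * n.-tuple R => f (scale_tuple r [tuple of p.1 :: p.2]))).
    by apply: (measurableT_comp mfs); exact: measurable_cons.
  by move=> x; exact: f0.
- by move=> x _; apply: integral_ge0.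
- by rewrite lee_fin exprn_ge0// ltW.
Qed.

End LebesgueTupleIntegral.

(** * Euclidean norm, scaling and radial projection *)

Section Enorm.
Variable R : realType.
Implicit Types (r : R).

Lemma enorm_ge0 n (x : n.-tuple R) : 0 <= enorm x.
Proof. exact: sqrtr_ge0. Qed.

Lemma sqr_enorm n (x : n.-tuple R) : enorm x ^+ 2 = \sum_(i < n) tnth x i ^+ 2.
Proof. by rewrite sqr_sqrtr// sumr_ge0// => i _; exact: sqr_ge0. Qed.

Lemma enorm_scale_tuple n r (x : n.-tuple R) :
  enorm (scale_tuple r x) = `|r| * enorm x.
Proof.
rewrite -sqrtr_sqr -sqrtrM ?sqr_ge0//; congr Num.sqrt.
by rewrite mulr_sumr; apply: eq_bigr => i _; rewrite tnth_mktuple exprMn.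
Qed.

Lemma sqr_enorm_rcons n (y : n.-tuple R) (z : R) :
  enorm [tuple of rcons y z] ^+ 2 = enorm y ^+ 2 + z ^+ 2.
Proof.
rewrite !sqr_enorm big_ord_recr/=; congr (_ + _ ^+ 2).
  apply: eq_bigr => i _; congr (_ ^+ 2).
  by rewrite !(tnth_nth 0) /= nth_rcons size_tuple ltn_ord.
by rewrite (tnth_nth 0) /= nth_rcons size_tuple ltnn eqxx.
Qed.

Lemma ler_enorm n (x : n.-tuple R) i : `|tnth x i| <= enorm x.
Proof.
rewrite -(@ler_pXn2r _ 2) ?nnegrE ?enorm_ge0// sqr_enorm real_normK ?num_real//.
by rewrite (bigD1 i)//= lerDl sumr_ge0// => j _; exact: sqr_ge0.
Qed.

Lemma scale_radial n (x : n.-tuple R) : scale_tuple (enorm x) (radial x) = x.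
Proof.
apply: eq_from_tnth => i; rewrite !tnth_mktuple.
(* At the origin [radial] divides by zero and returns the origin, so both sides vanish. *)
have [x0|x0] := eqVneq (enorm x) 0; last by rewrite mulrC divfK.
by apply/esym/eqP; rewrite x0 mul0r -normr_le0 -x0 ler_enorm.
Qed.

Lemma radial_scale n r (x : n.-tuple R) : 0 < r ->
  radial (scale_tuple r x) = radial x.
Proof.
move=> r0; apply: eq_from_tnth => i; rewrite !tnth_mktuple enorm_scale_tuple.
by rewrite gtr0_norm// -mulf_div divff ?gt_eqF// mul1r.
Qed.

Lemma enorm_radial n (x : n.-tuple R) : enorm x != 0 -> enorm (radial x) = 1.
Proof.
move=> x0; have := enorm_scale_tuple (enorm x) (radial x).
rewrite scale_radial ger0_norm ?enorm_ge0// => /(congr1 (fun u => u / enorm x)).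
by rewrite divff// mulrC mulKf// => ->.
Qed.

(** The norm is 1 off the origin and 0 at it, by the convention on division by zero; a bound valid
    at every point spares later case distinctions. *)
Lemma enorm_radial_le1 n (x : n.-tuple R) : enorm (radial x) <= 1.
Proof.
have [x0|/enorm_radial->//] := eqVneq (enorm x) 0.
suff -> : enorm (radial x) = 0 by [].
apply/eqP; rewrite sqrtr_eq0 big1// => i _.
by rewrite tnth_mktuple x0 invr0 mulr0 expr0n.
Qed.

Definition cball n (r : R) : set (n.-tuple R) := [set x | enorm x <= r].

Lemma measurable_cball n r : measurable (@cball n r).
Proof.
rewrite (_ : @cball n r = setT `&` @enorm R n @^-1` `]-oo, r]).
  by apply: measurable_enorm => //; exact: measurable_itv.
by rewrite setTI; apply/seteqP; split=> x /=; rewrite in_itv.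
Qed.

Lemma preimage_scale_cball n r s : 0 < r ->
  @scale_tuple R n r @^-1` cball (r * s) = cball s.
Proof.
move=> r0; apply/seteqP; split => x;
by rewrite /cball /= enorm_scale_tuple gtr0_norm// ler_pM2l.
Qed.

End Enorm.

(** * From non-negative to signed integrands *)

Section Transfer.
Local Open Scope ereal_scope.

Lemma patch_comp (T U : Type) (R : realType) (f : U -> \bar R) (phi : T -> U) (D : set U) :
  (f \_ D) \o phi = (f \o phi) \_ (phi @^-1` D).
Proof.
apply/funext => x /=; rewrite /patch /=.
by congr (if _ then _ else _); apply/idP/idP; rewrite !inE.
Qed.

Context d1 d2 (T1 : measurableType d1) (T2 : measurableType d2) (R : realType).

(** Tonelli, scaling and image-measure formulas come for non-negative functions. Positive and
    negative parts extend any of them, together with integrability, to signed functions. *)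
Lemma Rintegral_transfer (mu : {measure set T1 -> \bar R})
    (nu : {measure set T2 -> \bar R}) D E (phi : T2 -> T1) (k : R) :
  measurable D -> measurable E -> measurable_fun setT phi ->
  (forall f : T1 -> R, measurable_fun setT f -> (forall x, 0 <= f x)%R ->
    \int[mu]_(x in D) (f x)%:E = k%:E * \int[nu]_(y in E) (f (phi y))%:E) ->
  forall f, measurable_fun setT f -> nu.-integrable E (EFin \o (f \o phi)) ->
    mu.-integrable D (EFin \o f) /\
    (\int[mu]_(x in D) f x = k * \int[nu]_(y in E) f (phi y))%R.
Proof.
move=> mD mE mphi H f mf fint.
have int0 (g : T1 -> R) : measurable_fun setT g -> (forall x, 0 <= g x)%R ->
    nu.-integrable E (EFin \o (g \o phi)) -> mu.-integrable D (EFin \o g).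
  move=> mg g0 gint; apply/integrableP; split.
    by apply/measurable_EFinP; exact: measurable_funTS.
  under eq_integral do rewrite /= ger0_norm//.
  rewrite H// ltey_eq fin_numM//.
  exact: (integrable_fin_num mE gint).
have R0 (g : T1 -> R) : measurable_fun setT g -> (forall x, 0 <= g x)%R ->
    nu.-integrable E (EFin \o (g \o phi)) ->
    (\int[mu]_(x in D) g x = k * \int[nu]_(y in E) g (phi y))%R.
  move=> mg g0 gint; rewrite /Rintegral H// fineM//.
  exact: (integrable_fin_num mE gint).
have mfp := measurable_funrpos mf; have mfn := measurable_funrneg mf.
have fp0 := funrpos_ge0 f; have fn0 := funrneg_ge0 f.
have ip : nu.-integrable E (EFin \o (f^\+ \o phi)%R).
  exact: (integrable_funrpos mE fint).
have in_ : nu.-integrable E (EFin \o (f^\- \o phi)%R).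
  exact: (integrable_funrneg mE fint).
have fE x : (f x = f^\+ x - f^\- x)%R by rewrite -[in LHS](funrposBneg f).
split.
  rewrite (_ : _ \o _ = (EFin \o f^\+%R) \- (EFin \o f^\-%R)).
    by apply: integrableB => //; exact: int0.
  by apply/funext => x /=; rewrite fE.
under eq_Rintegral do rewrite fE.
under [in RHS]eq_Rintegral do rewrite fE.
rewrite (RintegralB mD)//; [|exact: int0|exact: int0].
rewrite (RintegralB mE)//.
by rewrite mulrBr R0// R0.
Qed.

Lemma fubini_bounded (m1 : {sigma_finite_measure set T1 -> \bar R})
    (m2 : {sigma_finite_measure set T2 -> \bar R}) A (h : T1 * T2 -> R) (M : R) :
  measurable A -> (m1 \x m2) A < +oo -> measurable_fun setT h ->
  (forall p, A p -> `|h p| <= M)%R ->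
  [/\ (m1 \x m2).-integrable A (EFin \o h),
    \int[m1]_x \int[m2]_(y in xsection A x) (h (x, y))%:E =
      \int[m1 \x m2]_(p in A) (h p)%:E &
    \int[m2]_y \int[m1]_(x in ysection A y) (h (x, y))%:E =
      \int[m1 \x m2]_(p in A) (h p)%:E].
Proof.
move=> mA Afin mh hM.
have hint : (m1 \x m2).-integrable A (EFin \o h).
  apply: measurable_bounded_integrable => //; first exact: measurable_funTS.
  exists M; split; first exact: num_real.
  by move=> N MN p Ap; exact: (le_trans (hM _ Ap) (ltW MN)).
(* Fubini is applied on the whole product to the extension of [h] by zero, whose partial functions
   are extensions by zero from the sections of [A]. *)
have hintT : (m1 \x m2).-integrable setT ((EFin \o h) \_ A).
  by apply/(integrable_mkcond _ mA).
split => //.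
- rewrite [RHS]integral_mkcond.
  rewrite -[RHS](@integral12_prod_meas1 _ _ _ _ _ m1 m2 _ hintT); apply: eq_integral => x _.
  rewrite /fubini_F [LHS]integral_mkcond; apply: eq_integral => y _.
  rewrite /patch /=; congr (if _ then _ else _).
  by apply/idP/idP; rewrite !inE/= /xsection/= inE.
- rewrite [RHS]integral_mkcond.
  rewrite -[RHS](@integral21_prod_meas1 _ _ _ _ _ m1 m2 _ hintT); apply: eq_integral => x _.
  rewrite /fubini_G [LHS]integral_mkcond; apply: eq_integral => y _.
  rewrite /patch /=; congr (if _ then _ else _).
  by apply/idP/idP; rewrite !inE/= /ysection/= inE.
Qed.

End Transfer.

(** * Lebesgue measure of balls *)

Section BallMeasure.
Variable R : realType.
Local Open Scope ereal_scope.
Local Notation mu := (@lebesgue_measure R).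
Local Notation lt := (lebesgue_tuple R).

(** The height comes first in the pair, so that an [xsection] of a ball is its slice at a given
    height. *)
Definition cons_last n (p : R * n.-tuple R) : n.+1.-tuple R :=
  [tuple of rcons p.2 p.1].

Lemma measurable_cons_last n : measurable_fun setT (@cons_last n).
Proof.
rewrite (_ : @cons_last n =
  (fun p : n.-tuple R * R => [tuple of rcons p.1 p.2]) \o (fun p => (p.2, p.1)))//.
apply: (measurableT_comp (@measurable_rcons R n)).
by apply/measurable_fun_pairP; split; [exact: measurable_snd|exact: measurable_fst].
Qed.

Lemma measurable_cons_last_preimage n (D : set (n.+1.-tuple R)) :
  measurable D -> measurable (@cons_last n @^-1` D).
Proof. by move=> mD; rewrite -[X in measurable X]setTI; exact: measurable_cons_last. Qed.

Lemma measurable_scale_preimage n r (D : set (n.-tuple R)) :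
  measurable D -> measurable (scale_tuple r @^-1` D).
Proof. by move=> mD; rewrite -[X in measurable X]setTI; exact: measurable_scale_tuple. Qed.

Lemma ge0_integral_cons_last n D (f : n.+1.-tuple R -> \bar R) :
  measurable D -> measurable_fun setT f -> (forall v, 0 <= f v) ->
  \int[lt n.+1]_(x in D) f x =
  \int[mu \x lt n]_(p in @cons_last n @^-1` D) f (cons_last p).
Proof.
move=> mD mf f0; rewrite [LHS]integral_mkcond [RHS]integral_mkcond.
have mfD : measurable_fun setT (f \_ D).
  by apply/(measurable_restrictT _ mD); exact: measurable_funTS.
have fD0 v : 0 <= (f \_ D) v by rewrite erestrict_ge0.
rewrite (ge0_integral_lebesgue_rcons mfD fD0) -(patch_comp f (@cons_last n) D).
rewrite (@fubini_tonelli1 _ _ _ _ _ mu (lt n) ((f \_ D) \o @cons_last n)) //.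
- exact: (measurableT_comp mfD (@measurable_cons_last n)).
- by move=> p; exact: fD0.
Qed.

Lemma ge0_integral_scale_set n r D (f : n.-tuple R -> \bar R) : (0 < r)%R ->
  measurable D -> measurable_fun setT f -> (forall v, 0 <= f v) ->
  \int[lt n]_(x in D) f x =
  (r ^+ n)%:E * \int[lt n]_(x in scale_tuple r @^-1` D) f (scale_tuple r x).
Proof.
move=> r0 mD mf f0; rewrite [LHS]integral_mkcond [in RHS]integral_mkcond.
have mfD : measurable_fun setT (f \_ D).
  by apply/(measurable_restrictT _ mD); exact: measurable_funTS.
have fD0 v : 0 <= (f \_ D) v by rewrite erestrict_ge0.
by rewrite (ge0_integral_scale_tuple r0 mfD fD0) -(patch_comp f (scale_tuple r) D).
Qed.

Lemma lebesgue_tuple_cons_last n D : measurable D ->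
  lt n.+1 D = (mu \x lt n) (@cons_last n @^-1` D).
Proof.
move=> mD; have mD' := measurable_cons_last_preimage mD.
have := @ge0_integral_cons_last n D (cst 1) mD (measurable_cst _) (fun=> lee01).
by rewrite !integral_cst// !mul1e.
Qed.

Lemma lebesgue_tuple_scale n r D : (0 < r)%R -> measurable D ->
  lt n D = (r ^+ n)%:E * lt n (scale_tuple r @^-1` D).
Proof.
move=> r0 mD; have mD' := @measurable_scale_preimage n r _ mD.
have := @ge0_integral_scale_set n r D (cst 1) r0 mD (measurable_cst _) (fun=> lee01).
by rewrite !integral_cst// !mul1e.
Qed.

(** By induction: the unit ball lies in the product of [-1, 1] and the unit ball of one dimension
    less. *)
Lemma lebesgue_unit_ball_lty n : lt n (cball 1) < +oo.
Proof.
elim: n => [|n IH]; first by rewrite /= diracE ltry.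
rewrite lebesgue_tuple_cons_last; last exact: measurable_cball.
apply: (@le_lt_trans _ _ ((mu \x lt n) (`[(-1)%R, 1%R] `*` cball 1))).
  apply: le_measure; rewrite ?inE.
  - exact: (measurable_cons_last_preimage (@measurable_cball _ _ _)).
  - by apply: measurableX => //; exact: measurable_cball.
  move=> [z y]; rewrite /cball /= => h.
  have := sqr_enorm_rcons y z.
  have e1 : (enorm [tuple of rcons y z] ^+ 2 <= 1)%R by rewrite expr_le1 ?enorm_ge0.
  move=> e; rewrite in_itv/= -ler_norml -(@expr_le1 _ 2)// real_normK ?num_real//.
  rewrite -(@expr_le1 _ 2 (enorm y)) ?enorm_ge0//.
  by rewrite e in e1; split; apply: le_trans e1; rewrite ?lerDl ?lerDr sqr_ge0.
rewrite product_measure1E//; last exact: measurable_cball.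
have I : mu `[(-1)%R, 1%R] = 2%:E.
  rewrite lebesgue_measure_itv/= lte_fin -EFinB.
  by rewrite (_ : (-1 < 1 :> R)%R) ?opprK//; lra.
by rewrite lte_mul_pinfty// [X in X \is a _]I.
Qed.

(** By induction: the unit ball contains the product of [0, 1/2] and a ball of radius 1/2, as 1/4 +
    1/4 <= 1. *)
Lemma lebesgue_unit_ball_gt0 n : 0 < lt n (cball 1).
Proof.
elim: n => [|n IH].
  rewrite /= diracE mem_set ?lte01// /cball/= /enorm big_ord0 sqrtr0; exact: ler01.
rewrite lebesgue_tuple_cons_last; last exact: measurable_cball.
apply: (@lt_le_trans _ _ ((mu \x lt n) (`[0%R, 2^-1%R] `*` cball 2^-1%R))).
  rewrite product_measure1E//; last exact: measurable_cball.
  rewrite mule_gt0//.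
    rewrite [ltRHS](_ : _ = mu `[0%R, 2^-1%R])//.
    by rewrite lebesgue_measure_itv/= lte_fin invr_gt0 ltr0n sube0 lte_fin invr_gt0.
  have h2 : (0 < 2^-1 :> R)%R by rewrite invr_gt0.
  rewrite (lebesgue_tuple_scale h2); last exact: measurable_cball.
  rewrite -{1}[X in cball X](mulr1) preimage_scale_cball//.
  by rewrite mule_gt0// lte_fin exprn_gt0.
apply: le_measure; rewrite ?inE.
- by apply: measurableX => //; exact: measurable_cball.
- exact: (measurable_cons_last_preimage (@measurable_cball _ _ _)).
move=> [z y]; rewrite /cball /= in_itv/= => -[/andP[z0 z1] y1].
rewrite -(@expr_le1 _ 2) ?enorm_ge0// sqr_enorm_rcons.
have := enorm_ge0 y.
rewrite /=; move: (enorm y) (z : R) z0 z1 y1 => {z} e z; nra.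
Qed.

Lemma lebesgue_ball_lty n r : (0 <= r)%R -> lt n (cball r) < +oo.
Proof.
(* Scaling needs a positive factor, and r may be 0. *)
move=> r0; have r1 : (0 < r + 1)%R by rewrite ltr_wpDl.
apply: (@le_lt_trans _ _ (lt n (cball ((r + 1) * 1)%R))).
  apply: le_measure; rewrite ?inE; try exact: measurable_cball.
  by move=> x; rewrite /cball/= mulr1 => /le_trans; apply; rewrite lerDl.
rewrite (lebesgue_tuple_scale r1); last exact: measurable_cball.
by rewrite preimage_scale_cball// lte_mul_pinfty ?lee_fin ?exprn_ge0 ?ltW// lebesgue_unit_ball_lty.
Qed.

(** Scaling by 2 preserves the origin but multiplies its measure, which is finite, by 2^n > 1. *)
Lemma lebesgue_origin n : (0 < n)%N -> lt n (cball 0) = 0.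
Proof.
move=> n0; have fin : lt n (cball 0) \is a fin_num.
  by rewrite ge0_fin_numE// lebesgue_ball_lty.
have := @lebesgue_tuple_scale n 2%R (cball 0) (ltr0Sn _ _) (@measurable_cball R n 0).
rewrite -{2}[X in cball X](mulr0 2%R) preimage_scale_cball//.
rewrite -(fineK fin) -EFinM => -[].
move=> /eqP; rewrite -subr_eq0 -{1}[fine _]mul1r -mulrBl mulf_eq0 => /orP[|/eqP->//].
rewrite subr_eq0 => /eqP e.
have : (1 < 2 ^+ n :> R)%R by rewrite exprn_egt1// ?ltr1n// -lt0n.
by rewrite -e ltxx.
Qed.

End BallMeasure.

(** * One-dimensional integrals *)

Section Calculus.
Variable R : realType.
Local Notation mu := (@lebesgue_measure R).
Implicit Types (f F G : R -> R) (a b : R).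

Lemma is_derive_continuous f F : (forall x : R, is_derive x 1 F (f x)) -> continuous F.
Proof.
move=> dF x; apply/differentiable_continuous/derivable1_diffP.
by have [] := dF x.
Qed.

Lemma is_derive_derive1 f F : (forall x : R, is_derive x 1 F (f x)) -> derive1 F = f.
Proof. by move=> dF; apply/funext => x; rewrite derive1E; have [_] := dF x. Qed.

Lemma is_derive_LRcontinuous f F a b :
  (forall x : R, is_derive x 1 F (f x)) -> derivable_oo_LRcontinuous F a b.
Proof.
move=> dF; have cF := is_derive_continuous dF; split.
- by move=> x _; have [] := dF x.
- exact/cvg_at_right_filter/cF.
- exact/cvg_at_left_filter/cF.
Qed.

Lemma continuous_integrable f a b : continuous f ->
  mu.-integrable `[a, b] (EFin \o f).
Proof.
move=> cf; apply: continuous_compact_integrable; first exact: segment_compact.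
exact: continuous_subspaceT.
Qed.

Lemma integral_is_derive f F a b : a <= b -> continuous f ->
  (forall x : R, is_derive x 1 F (f x)) ->
  (\int[mu]_(x in `[a, b]) (f x)%:E = (F b - F a)%:E)%E.
Proof.
rewrite le_eqVlt => /predU1P[->|ab] cf dF.
  by rewrite set_itv1 integral_set1 subrr.
rewrite EFinB; apply: continuous_FTC2 => //.
- exact: continuous_subspaceT.
- exact: is_derive_LRcontinuous dF.
- by move=> x _; rewrite (is_derive_derive1 dF).
Qed.

Lemma Rintegral_substitution_decreasing f F G a b : a <= b ->
  {in `[a, b] &, {homo F : x y /~ x < y}} -> continuous f -> continuous G ->
  (forall x : R, is_derive x 1 F (f x)) ->
  \int[mu]_(x in `[F b, F a]) G x = \int[mu]_(x in `[a, b]) (G (F x) * - f x).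
Proof.
move=> ab dec cf cG dF; rewrite /Rintegral.
rewrite (integration_by_substitution_decreasing ab dec)//.
- by congr fine; apply: eq_integral => x _; rewrite (is_derive_derive1 dF).
- by rewrite (is_derive_derive1 dF) => x _; exact: cf.
- rewrite (is_derive_derive1 dF); apply/cvg_ex; exists (f a).
  exact/cvg_at_right_filter/cf.
- rewrite (is_derive_derive1 dF); apply/cvg_ex; exists (f b).
  exact/cvg_at_left_filter/cf.
- exact: is_derive_LRcontinuous dF.
- exact: continuous_subspaceT.
Qed.

Lemma Rintegral_substitution_increasing f F G a b : a <= b ->
  {in `[a, b] &, {homo F : x y / x < y}} -> continuous f -> continuous G ->
  (forall x : R, is_derive x 1 F (f x)) ->
  \int[mu]_(x in `[F a, F b]) G x = \int[mu]_(x in `[a, b]) (G (F x) * f x).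
Proof.
move=> ab inc cf cG dF; rewrite /Rintegral.
rewrite (integration_by_substitution_increasing ab inc)//.
- by congr fine; apply: eq_integral => x _; rewrite (is_derive_derive1 dF).
- by rewrite (is_derive_derive1 dF) => x _; exact: cf.
- rewrite (is_derive_derive1 dF); apply/cvg_ex; exists (f a).
  exact/cvg_at_right_filter/cf.
- rewrite (is_derive_derive1 dF); apply/cvg_ex; exists (f b).
  exact/cvg_at_left_filter/cf.
- exact: is_derive_LRcontinuous dF.
- exact: continuous_subspaceT.
Qed.

Lemma continuous_funM f G : continuous f -> continuous G ->
  continuous (fun x => f x * G x).
Proof. by move=> cf cG x; apply: cvgM; [exact: cf|exact: cG]. Qed.

Lemma continuous_funZ (c : R) f : continuous f -> continuous (fun x => c * f x).
Proof. by move=> cf; apply: continuous_funM => // x; exact: cvg_cst. Qed.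

Lemma continuous_funX f n : continuous f -> continuous (fun x => f x ^+ n).
Proof.
move=> cf; elim: n => [|n IH]; first exact: cst_continuous.
rewrite (_ : (fun x => _) = (fun x => f x * f x ^+ n)).
  exact: continuous_funM.
by apply/funext => x; rewrite exprS.
Qed.

Lemma is_derive_mul f F (x df dF : R) : is_derive x 1 f df ->
  is_derive x 1 F dF -> is_derive x 1 (fun y => f y * F y) (f x * dF + F x * df).
Proof. by move=> h1 h2; exact: is_deriveM. Qed.

Lemma is_derive_exp f n (x df : R) : is_derive x 1 f df ->
  is_derive x 1 (fun y => f y ^+ n.+1) (n.+1%:R * f x ^+ n * df).
Proof.
move=> h; have := is_deriveX n.+1 h; rewrite /GRing.scale /=.
rewrite (_ : f ^+ n.+1 = (fun y => f y ^+ n.+1))//.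
by apply/funext => y; rewrite exprfctE.
Qed.

Lemma is_derive_pow n (x : R) :
  is_derive x 1 (fun y : R => y ^+ n.+1) (n.+1%:R * x ^+ n).
Proof.
by have := is_derive_exp n (is_derive_id x 1); rewrite mulr1.
Qed.

Lemma is_derive_affine (c e x : R) : is_derive x 1 (fun y => c * y + e) c.
Proof.
have h := is_deriveD (is_derive_mul (is_derive_cst c x 1) (is_derive_id x 1))
  (is_derive_cst e x 1).
by apply: (is_derive_eq h); rewrite /cst /= mulr1 mulr0 !addr0.
Qed.

Lemma integral_pow m a b : a <= b ->
  (\int[mu]_(x in `[a, b]) (m.+1%:R * x ^+ m)%:E = (b ^+ m.+1 - a ^+ m.+1)%:E)%E.
Proof.
move=> ab; apply: (@integral_is_derive _ (fun x => x ^+ m.+1)) => //.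
  apply: continuous_funM; first exact: cst_continuous.
  by apply: continuous_funX => x; exact: cvg_id.
move=> x; exact: is_derive_pow.
Qed.

Definition trig_integral k p := \int[mu]_(x in `[0, pi]) (cos x ^+ k * sin x ^+ p).

Lemma continuous_trig k p : continuous (fun x : R => cos x ^+ k * sin x ^+ p).
Proof.
apply: continuous_funM; apply: continuous_funX.
  exact: continuous_cos.
exact: continuous_sin.
Qed.

(** [F] vanishes at 0 and pi, and [f] is its derivative once cos^2 is replaced by 1 - sin^2. *)
Lemma trig_integral_rec k q :
  (q.+2 + k)%:R * trig_integral k q.+2 = q.+1%:R * trig_integral k q.
Proof.
have pi0 := pi_ge0 R.
pose F x : R := cos x ^+ k.+1 * sin x ^+ q.+1.
pose f x : R := q.+1%:R * (cos x ^+ k * sin x ^+ q)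
                  - (q.+2 + k)%:R * (cos x ^+ k * sin x ^+ q.+2).
have cf : continuous f.
  by move=> x; apply: cvgB; exact: (continuous_funZ (@continuous_trig _ _)).
have dF (x : R) : is_derive x 1 F (f x).
  have := is_derive_mul (is_derive_exp k (is_derive_cos x))
    (is_derive_exp q (is_derive_sin x)).
  move/is_derive_eq; apply; rewrite /f.
  have := cos2sin2 x; rewrite !exprS.
  move: (cos x) (sin x) => c s cs.
  transitivity (c ^+ k * s ^+ q * (q.+1%:R * (c * c) - k.+1%:R * (s * s))).
    ring.
  rewrite (_ : c * c = 1 - s * s); first ring.
  by move: cs; rewrite !expr0 !mulr1.
have : \int[mu]_(x in `[0, pi]) f x = 0.
  rewrite /Rintegral (integral_is_derive pi0 cf dF) /F sinpi sin0 !expr0n/=.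
  by rewrite !mulr0 subrr.
rewrite /f RintegralB//; last 2 first.
- apply: continuous_integrable.
  exact: (continuous_funZ (@continuous_trig _ _)).
- apply: continuous_integrable.
  exact: (continuous_funZ (@continuous_trig _ _)).
rewrite !RintegralZl//; last 2 first.
- by apply: continuous_integrable; exact: continuous_trig.
- by apply: continuous_integrable; exact: continuous_trig.
by move=> /eqP; rewrite subr_eq0 => /eqP ->.
Qed.

(** The reflection x -> pi - x changes the sign of cos and keeps sin; a meridian may thus be run in
    either direction. *)
Lemma trig_integral_sign (s : bool) k p :
  \int[mu]_(x in `[0, pi]) (((-1) ^+ s * cos x) ^+ k * sin x ^+ p) =
  trig_integral k p.
Proof.
case: s; last first.
  by apply: eq_Rintegral => x _; rewrite expr0 mul1r.
have pi0 := pi_ge0 R.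
have d (x : R) : is_derive x 1 (fun y => pi - y) (-1 : R).
  rewrite (_ : (fun y => _) = (fun y => -1 * y + pi)); first exact: is_derive_affine.
  by apply/funext => y; rewrite mulN1r addrC.
have := @Rintegral_substitution_decreasing (fun=> -1) (fun y => pi - y)
  (fun x => cos x ^+ k * sin x ^+ p) 0 pi pi0 _ _ (@continuous_trig k p) d.
rewrite subrr subr0 /trig_integral => ->.
- apply: eq_Rintegral => x _.
  rewrite cosB sinB cospi sinpi !mul0r sub0r addr0 mulN1r opprK mulr1.
  by rewrite mulN1r opprK.
- by move=> x y _ _ xy; rewrite ltrD2l ltrN2.
- by move=> x; exact: cvg_cst.
Qed.

(** Substitute z = cos x: the square root becomes sin x, which is non-negative on [0, pi], and the
    Jacobian adds one more sine. *)
Lemma Rintegral_cos k q :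
  \int[mu]_(z in `[-1, 1]) (z ^+ k * Num.sqrt (1 - z ^+ 2) ^+ q) =
  trig_integral k q.+1.
Proof.
have pi0 := pi_ge0 R.
pose G (z : R) := z ^+ k * Num.sqrt (1 - z ^+ 2) ^+ q.
have cG : continuous G.
  apply: continuous_funM; apply: continuous_funX; first by move=> x; exact: cvg_id.
  move=> x; apply: continuous_comp; last exact: sqrt_continuous.
  apply: cvgB; first exact: cvg_cst.
  by apply: (@continuous_funX id 2) => y; exact: cvg_id.
have := @Rintegral_substitution_decreasing (fun x => - sin x) (@cos R) G 0 pi pi0 _ _ cG (@is_derive_cos R).
rewrite cospi cos0 /trig_integral => ->.
- apply: eq_Rintegral => x; rewrite inE/= => x0pi.
  rewrite /G opprK -mulrA; congr (_ * _).
  rewrite -[1](cos2Dsin2 x) addrAC subrr add0r sqrtr_sqr ger0_norm ?exprSr//.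
  by apply: sin_ge0_pi.
- by move=> x y xI yI; rewrite ltr_cos.
- by move=> x; apply: cvgN; exact: continuous_sin.
Qed.

Lemma Rintegral_affine G a b : a < b -> continuous G ->
  \int[mu]_(u in `[a, b]) G (pi * ((u - a) / (b - a))) =
  (b - a) / pi * \int[mu]_(x in `[0, pi]) G x.
Proof.
move=> ab cG; have ba0 : 0 < b - a by rewrite subr_gt0.
have pi0 := pi_gt0 R.
pose F (u : R) : R := pi * ((u - a) / (b - a)).
have dF (x : R) : is_derive x 1 F (pi / (b - a)).
  rewrite (_ : F = (fun y => pi / (b - a) * y + - (pi / (b - a) * a))).
    exact: is_derive_affine.
  by apply/funext => y; rewrite /F; ring.
have := @Rintegral_substitution_increasing (fun=> pi / (b - a)) F G a b (ltW ab) _ _ cG dF.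
have -> : F a = 0 by rewrite /F subrr mul0r mulr0.
have -> : F b = pi by rewrite /F divff ?gt_eqF// mulr1.
move=> ->.
- rewrite RintegralZr.
  + rewrite mulrC -mulrA [X in _ * X](_ : _ = 1) ?mulr1//.
    by rewrite mulrA divfK ?gt_eqF// divff// gt_eqF.
  + exact: measurable_itv.
  + apply: continuous_integrable => x; apply: continuous_comp; last exact: cG.
    exact: (is_derive_continuous dF).
- move=> x y _ _ xy; rewrite /F ltr_pM2l// ltr_pM2r ?invr_gt0// ltrD2r//.
- by move=> x; exact: cvg_cst.
Qed.

End Calculus.

(** * Slicing the sphere *)

Section Homogeneous.
Variable R : realType.
Local Notation mu := (@lebesgue_measure R).
Local Notation lt := (lebesgue_tuple R).

(** As r = 0 is allowed and 0 ^+ 0 = 1, degree 0 means constant, which suits monomials. A function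
    [g \o radial] obeys the degree-0 law only for r > 0, and this weaker law is what
    [integral_cball_scale] assumes. *)
Definition homogeneous n m (g : n.-tuple R -> R) :=
  forall r x, 0 <= r -> g (scale_tuple r x) = r ^+ m * g x.

Lemma EFin_Rintegral d (T : measurableType d) (nu : {measure set T -> \bar R}) D f :
  measurable D -> nu.-integrable D (EFin \o f) ->
  (\int[nu]_(x in D) (f x)%:E = (\int[nu]_(x in D) f x)%R%:E)%E.
Proof. by move=> mD fint; rewrite fineK//; exact: integrable_fin_num fint. Qed.

Section Fixed.
Variables (n m : nat) (g : n.-tuple R -> R) (M : R).
Hypotheses (n_gt0 : (0 < n)%N) (mg : measurable_fun setT g)
  (gM : forall x, enorm x <= 1 -> `|g x| <= M).

Lemma integrable_unit_cball : (lt n).-integrable (cball 1) (EFin \o g).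
Proof.
apply: measurable_bounded_integrable; first exact: measurable_cball.
- exact: lebesgue_unit_ball_lty.
- exact: measurable_funTS.
- exists M; split; first exact: num_real.
  by move=> N MN p Ap; exact: (le_trans (gM Ap) (ltW MN)).
Qed.

Lemma integral_cball_scale r :
  (forall s x, 0 < s -> g (scale_tuple s x) = s ^+ m * g x) -> 0 <= r ->
  (lt n).-integrable (cball r) (EFin \o g) /\
  \int[lt n]_(x in cball r) g x = r ^+ (n + m) * \int[lt n]_(x in cball 1) g x.
Proof.
move=> gh; rewrite le_eqVlt => /predU1P[<-|r0].
  (* For r = 0 the ball is a null set, and the power of r is 0 because n > 0. *)
  rewrite expr0n addn_eq0 eqn0Ngt n_gt0 mul0r; split.
    apply: null_set_integrable; [exact: measurable_cball| |exact: lebesgue_origin].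
    by apply/measurable_EFinP; exact: measurable_funTS.
  rewrite /Rintegral null_set_integral//; first exact: measurable_cball.
  - by apply/measurable_EFinP; exact: measurable_funTS.
  - exact: lebesgue_origin.
have H (f : n.-tuple R -> R) : measurable_fun setT f -> (forall x, 0 <= f x) ->
    (\int[lt n]_(x in cball r) (f x)%:E =
    (r ^+ n)%:E * \int[lt n]_(y in cball 1) (f (scale_tuple r y))%:E)%E.
  move=> mf f0; rewrite (ge0_integral_scale_set r0 (@measurable_cball _ _ _))//.
  - by rewrite -[X in scale_tuple r @^-1` cball X](mulr1 r) preimage_scale_cball.
  - exact/measurable_EFinP.
have gE : g \o scale_tuple r = (fun x => r ^+ m * g x).
  by apply/funext => x /=; exact: gh.
have [|iD ->] := Rintegral_transfer (@measurable_cball _ _ _) (@measurable_cball _ _ _)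
   (@measurable_scale_tuple _ _ _) H mg.
  rewrite gE (_ : EFin \o _ = (fun x => ((r ^+ m)%:E * (EFin \o g) x)%E)).
    apply: integrableZl; [exact: measurable_cball|exact: integrable_unit_cball].
  by apply/funext => x /=; rewrite EFinM.
split=> //; rewrite exprD -mulrA; congr (_ * _).
rewrite -RintegralZl; [|exact: measurable_cball|exact: integrable_unit_cball].
by apply: eq_Rintegral => x _; exact: gh.
Qed.

End Fixed.

(* Layer cake: 1 - |x|^m is the integral of m s^(m-1) over [|x|, 1], so that
   Fubini reduces the left-hand side to the integrals of the degree-0 function
   g \o radial on balls. *)
Lemma integral_radial n m (g : n.-tuple R -> R) (M : R) :
  (0 < n)%N -> measurable_fun setT g -> homogeneous m g ->
  (forall x, enorm x <= 1 -> `|g x| <= M) ->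
  n%:R * \int[lt n]_(x in cball 1) g (radial x) =
  (n + m)%:R * \int[lt n]_(x in cball 1) g x.
Proof.
move=> n0 mg gh gM.
have gE x : g x = enorm x ^+ m * g (radial x).
  by rewrite -{1}(scale_radial x) gh ?enorm_ge0.
(* In degree 0 the layer-cake density is zero, but there [g] and [g \o radial] coincide. From here
   on the degree is m + 1. *)
case: m => [|m] in gh gE *.
  rewrite addn0; congr (_ * _); apply: eq_Rintegral => x _.
  by rewrite [RHS]gE expr0 mul1r.
pose g0 := g \o @radial R n.
have mg0 : measurable_fun setT g0 := measurableT_comp mg (@measurable_radial _ _).
have g0M x : `|g0 x| <= M by apply: gM; exact: enorm_radial_le1.
have M0 : 0 <= M by apply: le_trans (g0M [tuple 0 | i < n]).
have g0h s x : 0 < s -> g0 (scale_tuple s x) = s ^+ 0 * g0 x.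
  by move=> s0; rewrite /g0 /= radial_scale// expr0 mul1r.
(* For fixed x the section is [|x|, 1], and integrating [h] over it gives [g0 x - g x]; for fixed s
   in [0, 1] it is the ball of radius s, giving a multiple of s^(n + m). *)
pose A : set (n.-tuple R * measurableTypeR R) := [set p | enorm p.1 <= p.2 /\ p.2 <= 1].
have mA : measurable A.
  rewrite (_ : A = [set p | enorm p.1 <= p.2] `&` (setT `*` `]-oo, 1])); last first.
    by apply/seteqP; split=> -[x s] /=; rewrite /A/= in_itv/=; tauto.
  apply: measurableI; last exact: measurableX.
  rewrite -[X in measurable X]setTI.
  apply: measurable_fun_le => //.
  exact: (measurableT_comp (@measurable_enorm _ _) measurable_fst).
have Afin : ((lt n \x mu) A < +oo)%E.
  apply: (@le_lt_trans _ _ ((lt n \x mu) (cball 1 `*` `[0%R, 1%R]))%E).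
    apply: le_measure; rewrite ?inE//.
      by apply: measurableX => //; exact: measurable_cball.
    move=> [x s] [/= xs s1]; split; first exact: le_trans xs s1.
    by rewrite /= in_itv/= s1 (le_trans (enorm_ge0 x)).
  rewrite product_measure1E//; last exact: measurable_cball.
  have I : (mu `[0%R, 1%R] = 1%:E)%E by rewrite lebesgue_measure_itv/= lte_fin ltr01 oppr0 adde0.
  rewrite [X in (_ * X)%E](_ : _ = 1%:E)// mule1; exact: lebesgue_unit_ball_lty.
pose h (p : n.-tuple R * measurableTypeR R) : R := g0 p.1 * (m.+1%:R * p.2 ^+ m).
have mh : measurable_fun setT h.
  apply: measurable_funM; first exact: (measurableT_comp mg0 measurable_fst).
  by apply: measurable_funM => //; apply: measurable_funX; exact: measurable_snd.
have hM p : A p -> `|h p| <= M * m.+1%:R.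
  move=> [p1 p2]; rewrite /h normrM ler_pM// normrM normrX ger0_norm//.
  rewrite ler_piMr// exprn_ile1// ger0_norm//; exact: le_trans (enorm_ge0 _) p1.
have [_ E1 E2] := fubini_bounded mA Afin mh hM.
have ig := integrable_unit_cball mg gM.
have ig0 : (lt n).-integrable (cball 1) (EFin \o g0).
  by apply: (integrable_unit_cball mg0) => x _; exact: g0M.
have L1 : (\int[lt n]_x \int[mu]_(y in xsection A x) (h (x, y))%:E =
    \int[lt n]_(x in cball 1) (g0 x - g x)%:E)%E.
  rewrite [RHS]integral_mkcond; apply: eq_integral => x _; rewrite /patch.
  case: ifPn; rewrite ?notin_setE ?inE /cball/= => x1; last first.
    rewrite (_ : xsection A x = set0) ?integral_set0//.
    apply/seteqP; split=> s //; rewrite /xsection/= inE => -[/= xs s1].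
    by apply: x1; exact: le_trans xs s1.
  have -> : xsection A x = [set` `[enorm x, 1%R]].
    apply/seteqP; split=> s; rewrite /xsection/= inE /A/= in_itv/=.
      by move=> [-> ->].
    by move=> /andP[].
  under eq_integral do rewrite /h /= EFinM.
  rewrite integralZl//; last first.
    apply: continuous_integrable; apply: continuous_funZ.
    by apply: continuous_funX => s; exact: cvg_id.
  rewrite integral_pow// -EFinM; congr EFin.
  by rewrite expr1n mulrBr mulr1 mulrC -gE.
have L2 : (\int[mu]_s \int[lt n]_(x in ysection A s) (h (x, s))%:E =
    \int[mu]_(s in `[0%R, 1%R]) ((\int[lt n]_(x in cball 1) g0 x)%R * (m.+1%:R * s ^+ (n + m)))%:E)%E.
  rewrite [RHS]integral_mkcond; apply: eq_integral => s _; rewrite /patch.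
  case: ifPn; rewrite ?notin_setE ?inE /= in_itv/= => s01; last first.
    rewrite (_ : ysection A s = set0) ?integral_set0//.
    apply/seteqP; split=> x //; rewrite /ysection/= inE => -[/= xs s1].
    by apply: s01; rewrite s1 (le_trans (enorm_ge0 x) xs).
  move/andP: s01 => [s0 s1].
  have -> : ysection A s = cball s.
    by apply/seteqP; split=> x; rewrite /ysection/= inE /A/= /cball/= => // -[].
  have [is0 E0] := integral_cball_scale n0 mg0 (fun x _ => g0M x) g0h s0.
  have ms := @measurable_cball R n s.
  under eq_integral do rewrite /h /= EFinM.
  rewrite integralZr// EFin_Rintegral// -EFinM; congr EFin.
  rewrite [X in X * _]E0 addn0 exprD; ring.
have {E1 E2 L1 L2} : (\int[lt n]_(x in cball 1) (g0 x - g x)%:E =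
  \int[mu]_(s in `[0%R, 1%R]) ((\int[lt n]_(x in cball 1) g0 x)%R * (m.+1%:R * s ^+ (n + m)))%:E)%E.
  by rewrite -L1 E1 -E2 L2.
move=> /(congr1 fine); rewrite -!/(Rintegral _ _ _).
rewrite RintegralB//; last exact: measurable_cball.
have cpow (c : R) k : mu.-integrable `[0, 1] (EFin \o (fun s => c * s ^+ k)).
  apply: continuous_integrable; apply: continuous_funZ.
  by apply: continuous_funX => s; exact: cvg_id.
have cX k : mu.-integrable `[0, 1] (EFin \o (fun s : R => s ^+ k)).
  apply: continuous_integrable.
  by apply: continuous_funX => s; exact: cvg_id.
rewrite RintegralZl// RintegralZl//.
(* The power integral [P] is 1 / (n + m + 1), so [E] below says G0 - G = G0 (m + 1) / (n + m + 1),
   which is the claim rearranged. *)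
have : \int[mu]_(s in `[0, 1]) ((n + m).+1%:R * s ^+ (n + m)) = 1.
  by rewrite /Rintegral integral_pow//= expr1n expr0n subr0.
rewrite RintegralZl//.
rewrite addnS -/(g0 _).
set P := Rintegral _ _ _ => EP; set G0 := Rintegral _ _ _; set G := Rintegral _ _ _ => E.
have -> : n%:R * G0 = (n + m).+1%:R * G0 - G0 * m.+1%:R * ((n + m).+1%:R * P).
  by rewrite EP -addnS natrD; ring.
have -> : G = G0 - (G0 - G) by rewrite subKr.
rewrite {}E; ring.
Qed.

(** On the slice at height z, a ball of radius sqrt(1 - z^2), homogeneity gives the (n + m)-th power
    of the radius; [Rintegral_cos] then raises the exponent by one. *)
Lemma integral_slice n m k (g : n.-tuple R -> R) (f : n.+1.-tuple R -> R) (M : R) :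
  (0 < n)%N -> measurable_fun setT g -> homogeneous m g ->
  (forall x, enorm x <= 1 -> `|g x| <= M) -> measurable_fun setT f ->
  (forall (y : n.-tuple R) z, f [tuple of rcons y z] = z ^+ k * g y) ->
  \int[lt n.+1]_(x in cball 1) f x =
  trig_integral R k (n + m).+1 * \int[lt n]_(x in cball 1) g x.
Proof.
move=> n0 mg gh gM mf fE.
pose E : set (measurableTypeR R * n.-tuple R) := @cons_last R n @^-1` cball 1.
have mE : measurable E by exact: (measurable_cons_last_preimage (@measurable_cball _ _ _)).
have Efin : ((mu \x lt n) E < +oo)%E.
  rewrite -lebesgue_tuple_cons_last; last exact: measurable_cball.
  exact: lebesgue_unit_ball_lty.
have EP z y : E (z, y) -> z ^+ 2 <= 1 /\ enorm y <= Num.sqrt (1 - z ^+ 2).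
  rewrite /E /cons_last /cball /= -(@expr_le1 _ 2) ?enorm_ge0// sqr_enorm_rcons => h.
  have z1 : z ^+ 2 <= 1 by apply: le_trans h; rewrite lerDr sqr_ge0.
  split=> //; rewrite -(@ler_pXn2r _ 2) ?nnegrE ?enorm_ge0 ?sqrtr_ge0//.
  by rewrite [leRHS]sqr_sqrtr ?subr_ge0// lerBrDr.
have PE z y : z ^+ 2 <= 1 -> enorm y <= Num.sqrt (1 - z ^+ 2) -> E (z, y).
  move=> z1 h; rewrite /E /cons_last /cball /= -(@expr_le1 _ 2) ?enorm_ge0// sqr_enorm_rcons.
  by rewrite -lerBrDr -[leRHS]sqr_sqrtr ?subr_ge0// ler_pXn2r ?nnegrE ?enorm_ge0 ?sqrtr_ge0.
have sqrt_le1 (z : R) : Num.sqrt (1 - z ^+ 2) <= 1.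
  by rewrite -[leRHS]sqrtr1 ler_sqrt// lerBlDr lerDl sqr_ge0.
pose h := f \o @cons_last R n.
have mh : measurable_fun setT h := measurableT_comp mf (@measurable_cons_last R n).
have hM p : E p -> `|h p| <= M.
  case: p => z y /EP[z1 yz]; rewrite /h /= fE normrM -[leRHS]mul1r.
  rewrite ler_pM// ?normr_ge0//; last by apply: gM; exact: le_trans yz (sqrt_le1 _).
  by rewrite normrX exprn_ile1// -(@expr_le1 _ 2)// real_normK ?num_real.
have [hint E1 _] := fubini_bounded mE Efin mh hM.
have H (f0 : n.+1.-tuple R -> R) : measurable_fun setT f0 -> (forall x, 0 <= f0 x) ->
  (\int[lt n.+1]_(x in cball 1) (f0 x)%:E =
   1%:E * \int[mu \x lt n]_(p in E) (f0 (cons_last p))%:E)%E.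
  move=> mf0 f00; rewrite mul1e; apply: (ge0_integral_cons_last (@measurable_cball _ _ _)).
    exact/measurable_EFinP.
  by move=> v; rewrite lee_fin.
have [_ ->] := Rintegral_transfer (@measurable_cball _ _ _) mE (@measurable_cons_last _ _) H mf hint.
have E3 : (\int[mu]_x \int[lt n]_(y in xsection E x) (h (x, y))%:E =
   \int[mu]_(z in `[(-1)%R, 1%R]) ((z ^+ k * Num.sqrt (1 - z ^+ 2) ^+ (n + m)) *
       \int[lt n]_(y in cball 1) g y)%:E)%E.
  rewrite [RHS]integral_mkcond; apply: eq_integral => z _; rewrite /patch.
  have zI : (z ^+ 2 <= 1) = (z \in `[-1, 1]).
    by rewrite in_itv/= -ler_norml -[RHS](@expr_le1 _ 2)// real_normK ?num_real.
  case: ifPn; rewrite ?notin_setE ?inE /= -zI => z1; last first.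
    rewrite (_ : xsection E z = set0) ?integral_set0//.
    by apply/seteqP; split=> y //; rewrite /xsection/= inE => /EP[].
  have -> : xsection E z = cball (Num.sqrt (1 - z ^+ 2)).
    apply/seteqP; split=> y; rewrite /xsection/= inE /=; first by case/EP.
    exact: PE.
  have mc := @measurable_cball R n (Num.sqrt (1 - z ^+ 2)).
  have [ir Er] := integral_cball_scale n0 mg gM (fun s x s0 => gh s x (ltW s0)) (sqrtr_ge0 (1 - z ^+ 2)).
  under eq_integral do rewrite /h /= fE EFinM /=.
  rewrite integralZl// EFin_Rintegral// -EFinM; congr EFin.
  by rewrite [X in _ * X]Er mulrA.
transitivity (\int[mu]_(z in `[-1, 1])
    (z ^+ k * Num.sqrt (1 - z ^+ 2) ^+ (n + m) * \int[lt n]_(y in cball 1) g y)).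
  by rewrite mul1r /Rintegral -E1 E3.
rewrite RintegralZr//; first by rewrite Rintegral_cos.
apply: continuous_integrable; apply: continuous_funM; apply: continuous_funX.
  by move=> x; exact: cvg_id.
move=> x; apply: continuous_comp; last exact: sqrt_continuous.
apply: cvgB; first exact: cvg_cst.
by apply: (@continuous_funX _ id 2) => y; exact: cvg_id.
Qed.

Lemma measurable_sphere n : measurable (@sphere R n).
Proof.
rewrite (_ : @sphere R n = setT `&` @enorm R n @^-1` [set 1]).
  by apply: measurable_enorm => //; exact: measurable_set1.
by rewrite setTI; apply/seteqP; split.
Qed.

Lemma ge0_integral_surface n (f : n.-tuple R -> R) : (0 < n)%N ->
  measurable_fun setT f -> (forall x, 0 <= f x) ->
  (\int[@surface_measure R n]_(x in @sphere R n) (f x)%:E =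
   n%:R%:E * \int[lt n]_(x in cball 1) (f (radial x))%:E)%E.
Proof.
move=> n0 mf f0.
have mS := @measurable_sphere n.
have f0' x : (0 <= (f x)%:E)%E by rewrite lee_fin.
have mf' : measurable_fun setT (EFin \o f) by exact/measurable_EFinP.
have mfr : measurable_fun setT (EFin \o (f \o @radial R n)).
  by apply/measurable_EFinP; exact: (measurableT_comp mf (@measurable_radial R n)).
rewrite ge0_integral_mscale//; last exact: measurable_funTS.
congr (_ * _)%E.
rewrite ge0_integral_pushforward//; [|exact: measurable_radial|exact: measurable_funTS].
set U := _ @^-1` _.
have mU : measurable U.
  by rewrite -[X in measurable X]setTI; exact: measurable_radial.
(* [radial] sends the origin to itself, off the sphere, and every other point onto the sphere. *)
have UE : U = ~` cball 0.
  apply/seteqP; split => x; rewrite /U /sphere /cball /=.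
    move=> x1 x0; have e0 : enorm x = 0 by apply/eqP; rewrite eq_le x0 enorm_ge0.
    have : enorm (scale_tuple (enorm x) (radial x)) = enorm x by rewrite scale_radial.
    move: x1 => /eqP; rewrite /enorm big1 ?sqrtr0 1?eq_sym ?oner_eq0// => i _.
    by rewrite tnth_mktuple [X in _ / X]e0 invr0 mulr0 expr0n.
  by move=> /negP; rewrite -ltNge => x0; rewrite enorm_radial// gt_eqF.
have mB := @measurable_unit_ball R n.
have mb1 := @measurable_cball R n 1.
have mb0 := @measurable_cball R n 0.
(* Two null sets are discarded: the part of [U] outside the unit ball, null for the restricted
   measure, and then the origin, null for Lebesgue measure. *)
rewrite (ge0_negligible_integral (measurableD mU mB)) //; last 3 first.
- exact: measurable_funTS mfr.
- by move=> x _; exact: f0'.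
- by rewrite /= /mrestr setIC setIDA setDE setIAC setICr set0I.
transitivity (\int[lt n]_(x in U `\` (U `\` @unit_ball R n)) (f (radial x))%:E)%E.
  apply: eq_measure_integral => A mA AU; rewrite /= /mrestr setIidl//.
  by move=> x /AU[Ux] /not_andP[//|]; rewrite notK.
rewrite [RHS](ge0_negligible_integral mb0 mb1)//; last 2 first.
- exact: measurable_funTS mfr.
- exact: lebesgue_origin.
by rewrite setDD UE setDE setIC.
Qed.

Lemma sphere_volumeE n : (0 < n)%N ->
  sphere_volume R n = n%:R * fine (lt n (cball 1)).
Proof.
move=> n0; have := @ge0_integral_surface n (cst 1) n0 (measurable_cst _) (fun=> ler01).
rewrite [X in X = _](integral_cst _ (@measurable_sphere n) 1%:E).
rewrite [X in _ = (_ * X)%E](integral_cst _ (@measurable_cball R n 1) 1%:E).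
rewrite !mul1e /sphere_volume => ->.
by rewrite fineM// ge0_fin_numE// lebesgue_unit_ball_lty.
Qed.

Lemma sphere_volume_gt0 n : (0 < n)%N -> 0 < sphere_volume R n.
Proof.
move=> n0; rewrite sphere_volumeE// mulr_gt0 ?ltr0n// fine_gt0//.
by rewrite lebesgue_unit_ball_gt0 lebesgue_unit_ball_lty.
Qed.

Lemma Rintegral_uniform_sphere n (g : n.-tuple R -> R) (M : R) : (0 < n)%N ->
  measurable_fun setT g -> (forall x, `|g (radial x)| <= M) ->
  (@uniform_measure R n).-integrable (@sphere R n) (EFin \o g) /\
  \int[@uniform_measure R n]_(x in @sphere R n) g x =
    (sphere_volume R n)^-1 * (n%:R * \int[lt n]_(x in cball 1) g (radial x)).
Proof.
move=> n0 mg gM; rewrite mulrA.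
apply: (Rintegral_transfer (@measurable_sphere _) (@measurable_cball _ _ _)
  (@measurable_radial _ _)) => //.
  move=> f mf f0; rewrite ge0_integral_mscale//.
  - by rewrite ge0_integral_surface// muleA -EFinM.
  - exact: measurable_sphere.
  - by apply/measurable_EFinP; exact: measurable_funTS.
  - by move=> x _; rewrite lee_fin.
apply: (integrable_unit_cball (measurableT_comp mg (@measurable_radial _ _))) => x _.
exact: gM.
Qed.

(** Passing to balls produces the factor n + 2 + m + k on the left and n + 1 + m on the right. With
    q = n + m, [trig_integral_rec] trades one for the other while lowering the exponent from the n +
    m + 2 of [integral_slice] to n + m. *)
Lemma uniform_slice n m k (g : n.+1.-tuple R -> R) (f : n.+2.-tuple R -> R) (M : R) :
  measurable_fun setT g -> homogeneous m g ->
  (forall x, enorm x <= 1 -> `|g x| <= M) ->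
  measurable_fun setT f -> homogeneous (m + k) f ->
  (forall x, enorm x <= 1 -> `|f x| <= M) ->
  (forall (y : n.+1.-tuple R) z, f [tuple of rcons y z] = z ^+ k * g y) ->
  \int[@uniform_measure R n.+2]_(x in @sphere R n.+2) f x =
  sphere_volume R n.+1 / sphere_volume R n.+2 * trig_integral R k (n + m) *
    \int[@uniform_measure R n.+1]_(x in @sphere R n.+1) g x.
Proof.
move=> mg gh gM mf fh fM fE.
have [_ ->] := @Rintegral_uniform_sphere n.+2 f M isT mf (fun x => fM _ (enorm_radial_le1 x)).
have [_ ->] := @Rintegral_uniform_sphere n.+1 g M isT mg (fun x => gM _ (enorm_radial_le1 x)).
rewrite (integral_radial _ mf fh fM)// (integral_radial _ mg gh gM)//.
rewrite (integral_slice _ mg gh gM mf fE)//.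
have -> : ((n.+2 + (m + k)) = (n + m).+2 + k)%N by rewrite !addSn addnA.
rewrite !addSn mulrA trig_integral_rec.
have V1 := sphere_volume_gt0 (ltn0Sn n).
have V2 := sphere_volume_gt0 (ltn0Sn n.+1).
by field; rewrite !gt_eqF.
Qed.

End Homogeneous.

(** * Weighted designs and meridians *)

Section SpherePolynomials.
Variable R : realType.
Local Notation mu := (@lebesgue_measure R).
Local Notation unif n := (@uniform_measure R n).

Definition monomial n (a : 'I_n -> nat) (x : n.-tuple R) : R :=
  \prod_(i < n) tnth x i ^+ a i.

Lemma measurable_monomial n (a : 'I_n -> nat) : measurable_fun setT (monomial a).
Proof.
apply: measurable_prod => i _.
by apply: measurable_funX; exact: measurable_tnth.
Qed.

Lemma monomial_scale n (a : 'I_n -> nat) r x :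
  monomial a (scale_tuple r x) = r ^+ (\sum_i a i) * monomial a x.
Proof.
rewrite -prodrXr -big_split/=; apply: eq_bigr => i _.
by rewrite tnth_mktuple exprMn.
Qed.

Lemma homogeneous_monomial n (a : 'I_n -> nat) :
  homogeneous (\sum_i a i) (monomial a).
Proof. by move=> r x _; exact: monomial_scale. Qed.

Lemma monomial_le1 n (a : 'I_n -> nat) x : enorm x <= 1 -> `|monomial a x| <= 1.
Proof.
move=> x1; rewrite /monomial normr_prod; apply: prodr_ile1 => i _.
rewrite normr_ge0 normrX exprn_ile1//.
exact: le_trans (ler_enorm _ _) x1.
Qed.

Lemma monomial_rcons n (a : 'I_n.+1 -> nat) (y : n.-tuple R) z :
  monomial a [tuple of rcons y z] =
  z ^+ a ord_max * monomial (fun i => a (widen_ord (leqnSn n) i)) y.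
Proof.
rewrite /monomial big_ord_recr/= mulrC; congr (_ ^+ _ * _).
  by rewrite (tnth_nth 0) /= nth_rcons size_tuple ltnn eqxx.
apply: eq_bigr => i _; congr (_ ^+ _).
by rewrite !(tnth_nth 0) /= nth_rcons size_tuple ltn_ord.
Qed.

Lemma meval_monomial n (p : mpoly.mpoly n R) (x : n.-tuple R) :
  mpoly.meval (tnth x) p =
  \sum_(m <- mpoly.msupp p) mpoly.mcoeff m p * monomial m x.
Proof. exact: mpoly.mevalE. Qed.

Lemma sphere_poly_monomial n t (a : 'I_n -> nat) :
  (\sum_i a i <= t)%N -> sphere_poly t (monomial a).
Proof.
move=> at_; exists (mpoly.mpolyX R (mpoly.Multinom [tuple a i | i < n])).
  rewrite mpoly.msizeX ltnS mpoly.mdegE; apply: leq_trans at_.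
  by apply: leq_sum => i _; rewrite mpoly.mnmE.
by move=> x _; rewrite mpoly.mevalX; apply: eq_bigr => i _; rewrite mpoly.mnmE.
Qed.

Lemma integrable_monomial n (a : 'I_n -> nat) : (0 < n)%N ->
  (unif n).-integrable (@sphere R n) (EFin \o monomial a).
Proof.
move=> n0; have [] // := @Rintegral_uniform_sphere R n (monomial a) 1 n0 (measurable_monomial a).
by move=> x; apply: monomial_le1; exact: enorm_radial_le1.
Qed.

Lemma integral_uniform1 n : (0 < n)%N ->
  \int[unif n]_(x in @sphere R n) monomial (fun=> 0%N) x = 1.
Proof.
move=> n0; have [|_ ->] := @Rintegral_uniform_sphere R n (monomial (fun=> 0%N)) 1 n0 (measurable_monomial _).
  by move=> x; apply: monomial_le1; exact: enorm_radial_le1.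
have V0 := sphere_volume_gt0 R n0.
rewrite [X in _ * (_ * X)](_ : _ = fine (lebesgue_tuple R n (cball 1))).
  by rewrite -sphere_volumeE// mulVf// gt_eqF.
rewrite -[RHS]mul1r -Rintegral_cst; last exact: measurable_cball.
by apply: eq_Rintegral => x _; rewrite /monomial big1.
Qed.

Lemma integral_sphere_poly n (p : mpoly.mpoly n R) f : (0 < n)%N ->
  {in @sphere R n, forall x, f x = mpoly.meval (tnth x) p} ->
  (\int[unif n]_(x in @sphere R n) (f x)%:E =
  (\sum_(m <- mpoly.msupp p) mpoly.mcoeff m p *
     \int[unif n]_(x in @sphere R n) monomial m x)%:E)%E.
Proof.
move=> n0 fp.
transitivity (\int[unif n]_(x in @sphere R n)
    (\sum_(m <- mpoly.msupp p) (mpoly.mcoeff m p)%:E * (monomial m x)%:E))%E.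
  apply: eq_integral => x xS; rewrite fp// meval_monomial -sumEFin.
  by apply: eq_bigr => m _; rewrite EFinM.
have mS := @measurable_sphere R n.
rewrite integral_sum//; last first.
  by move=> m; apply: integrableZl => //; exact: integrable_monomial.
rewrite -sumEFin; apply: eq_bigr => m _.
rewrite integralZl//; last exact: integrable_monomial.
by rewrite EFin_Rintegral//; exact: integrable_monomial.
Qed.

Lemma design_monomial n t (X : {fset n.-tuple R}) lam (a : 'I_n -> nat) :
  (0 < n)%N -> weighted_design_set t X lam -> (\sum_i a i <= t)%N ->
  \sum_(x <- X) monomial a x * lam x = \int[unif n]_(x in @sphere R n) monomial a x.
Proof.
move=> n0 [_ _ des] at_; apply: EFin_inj; rewrite des; last exact: sphere_poly_monomial.
by rewrite EFin_Rintegral//; [exact: measurable_sphere|exact: integrable_monomial].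
Qed.

Lemma continuous_sign_trig (s : bool) k p :
  continuous (fun th : R => ((-1) ^+ s * cos th) ^+ k * sin th ^+ p).
Proof.
apply: continuous_funM; apply: continuous_funX; last exact: continuous_sin.
by apply: continuous_funZ; exact: continuous_cos.
Qed.

Section Fixed.
Variables (n t N : nat) (X : {fset n.+1.-tuple R}) (lam : n.+1.-tuple R -> R).
Variable x : 'I_N -> n.+1.-tuple R.
Hypotheses (des : weighted_design_set t X lam) (x_inj : injective x)
  (X_x : X =i codom x).

Lemma design_sum (f : n.+1.-tuple R -> R) : \sum_(y <- X) f y = \sum_i f (x i).
Proof.
rewrite -[RHS](big_map x predT f); apply: perm_big.
apply: uniq_perm; first exact: fset_uniq.
  by rewrite map_inj_uniq// index_enum_uniq.
move=> y; rewrite X_x.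
apply/codomP/mapP => [[i ->]|[i _ ->]]; exists i => //.
by rewrite mem_index_enum.
Qed.

(** An empty design would integrate the constant 1 to 0, whereas the uniform measure has mass 1. *)
Lemma design_gt0 : (0 < N)%N.
Proof.
rewrite lt0n; apply/negP => /eqP N0.
have := design_monomial (ltn0Sn n) des (a := fun=> 0%N).
rewrite big1// => /(_ isT); rewrite integral_uniform1// design_sum big1.
  by move/eqP; rewrite eq_sym oner_eq0.
by move=> i; have := leq_ltn_trans (leq0n i) (ltn_ord i); rewrite N0.
Qed.

(** Here d = n + 1, so the power of sine is the density (sin th)^(d-1) of the surface measure; [s]
    selects the pole of departure. *)
Definition meridian (p : mpoly.mpoly n.+2 R) (s : bool) (y : n.+1.-tuple R) (th : R) :=
  sin th ^+ n *
  mpoly.meval (tnth [tuple of rcons (scale_tuple (sin th) y) ((-1) ^+ s * cos th)]) p.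

Lemma meridianE p s y th : meridian p s y th =
  \sum_(m <- mpoly.msupp p) mpoly.mcoeff m p *
    monomial (fun i => m (widen_ord (leqnSn n.+1) i)) y *
    (((-1) ^+ s * cos th) ^+ m ord_max *
     sin th ^+ (n + \sum_(i < n.+1) m (widen_ord (leqnSn n.+1) i))).
Proof.
rewrite /meridian meval_monomial mulr_sumr; apply: eq_bigr => m _.
rewrite monomial_rcons monomial_scale exprD; ring.
Qed.

Lemma continuous_meridian p s y : continuous (meridian p s y).
Proof.
rewrite (_ : meridian p s y = (fun th => \sum_(m <- mpoly.msupp p) mpoly.mcoeff m p *
    monomial (fun i => m (widen_ord (leqnSn n.+1) i)) y *
    (((-1) ^+ s * cos th) ^+ m ord_max *
     sin th ^+ (n + \sum_(i < n.+1) m (widen_ord (leqnSn n.+1) i))))); last first.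
  by apply/funext => th; exact: meridianE.
apply: continuous_big => [|m _]; first exact: add_continuous.
exact: (continuous_funZ (@continuous_sign_trig _ _ _)).
Qed.

Lemma integral_meridian p s y : \int[mu]_(th in `[0, pi]) meridian p s y th =
  \sum_(m <- mpoly.msupp p) mpoly.mcoeff m p *
    monomial (fun i => m (widen_ord (leqnSn n.+1) i)) y *
    trig_integral R (m ord_max) (n + \sum_(i < n.+1) m (widen_ord (leqnSn n.+1) i)).
Proof.
under eq_Rintegral do rewrite meridianE.
have cst_ k q : mu.-integrable `[0, pi] (EFin \o (fun th : R => ((-1) ^+ s * cos th) ^+ k * sin th ^+ q)).
  by apply: continuous_integrable; exact: continuous_sign_trig.
rewrite /Rintegral.
under eq_integral do rewrite -sumEFin.
rewrite integral_sum//; last first.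
  move=> m; apply: continuous_integrable.
  exact: (continuous_funZ (@continuous_sign_trig _ _ _)).
rewrite (_ : (\sum_(i <- _) _)%E = (\sum_(m <- mpoly.msupp p) mpoly.mcoeff m p *
    monomial (fun i => m (widen_ord (leqnSn n.+1) i)) y *
    trig_integral R (m ord_max) (n + \sum_(i < n.+1) m (widen_ord (leqnSn n.+1) i)))%:E)//.
rewrite -sumEFin; apply: eq_bigr => m _.
under eq_integral do rewrite EFinM.
rewrite integralZl//; last exact: cst_.
by rewrite EFin_Rintegral// -EFinM trig_integral_sign.
Qed.

(** Monomial by monomial, [uniform_slice] leaves an integral over the equatorial sphere, which the
    design evaluates. The directions [s i] are arbitrary since the integral of a meridian does not
    depend on them. *)
Lemma design_meridian f (p : mpoly.mpoly n.+2 R) (s : 'I_N -> bool) :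
  (mpoly.msize p <= t.+1)%N ->
  {in @sphere R n.+2, forall x, f x = mpoly.meval (tnth x) p} ->
  (\int[unif n.+2]_(y in @sphere R n.+2) (f y)%:E =
   (\sum_i lam (x i) * (volume_ratio R n.+1 *
     \int[mu]_(th in `[0, pi]) meridian p (s i) (x i) th))%:E)%E.
Proof.
move=> pt fp; rewrite (integral_sphere_poly _ fp)//; congr EFin.
under [RHS]eq_bigr => i _ do rewrite integral_meridian 2!mulr_sumr.
rewrite exchange_big/=; apply: eq_big_seq => m mp.
set a := fun i : 'I_n.+1 => _.
have ma : (\sum_i m i = \sum_i a i + m ord_max)%N by rewrite big_ord_recr.
(* [a] is [m] without its last exponent, so its degree is at most that of [m]. *)
have at_ : (\sum_i a i <= t)%N.
  have := mpoly.msize_mdeg_lt mp; rewrite mpoly.mdegE ma => h.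
  by rewrite -ltnS (leq_trans _ pt)// (leq_ltn_trans _ h)// leq_addr.
rewrite (@uniform_slice R n (\sum_i a i) (m ord_max) (monomial a) (monomial m) 1).
- rewrite -(design_monomial _ des at_)// design_sum !mulr_sumr; apply: eq_bigr => i _.
  rewrite /volume_ratio; ring.
- exact: measurable_monomial.
- exact: homogeneous_monomial.
- by move=> y; exact: monomial_le1.
- exact: measurable_monomial.
- by rewrite -ma; exact: homogeneous_monomial.
- by move=> y; exact: monomial_le1.
- by move=> y z; exact: monomial_rcons.
Qed.

End Fixed.
End SpherePolynomials.

(** * Functions given piecewise on a subdivision *)

Section Subdivision.
Variable R : realType.
Local Notation mu := (@lebesgue_measure R).

(** Weight and speed are controlled only inside the pieces; the two end points form a null set. *)
Lemma integral_itv_open_eq (F G : R -> R) (a b : R) : continuous G ->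
  {in `]a, b[, F =1 G} ->
  mu.-integrable `[a, b] (EFin \o F) /\
  \int[mu]_(x in `[a, b]) F x = \int[mu]_(x in `[a, b]) G x.
Proof.
move=> cG FG.
have iG := continuous_integrable a b cG.
have mF : measurable_fun `[a, b] (EFin \o F).
  apply/measurable_EFinP; apply: (@measurable_fun_itv_cc _ _ _ false true).
  apply: (@eq_measurable_fun _ _ _ _ _ G); first by move=> x /set_mem xab; rewrite FG.
  by apply: measurable_funTS; exact: continuous_measurable_fun.
pose N : set (measurableTypeR R) := [set a; b].
have mN : measurable N by apply: measurableU; exact: measurable_set1.
have N0 : mu N = 0%E by apply: countable_lebesgue_measure0; exact/finite_set_countable/finite_set2.
have FGN : {in `[a, b] `\` N, F =1 G}.
  move=> x /set_mem [/=]; rewrite in_itv/= => /andP[ax xb] /not_orP[xa xb'].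
  apply: FG; rewrite in_itv/= !lt_neqAle ax xb !andbT; apply/andP; split; apply/eqP.
    by move=> h; exact: xa.
  by [].
have iF : mu.-integrable `[a, b] (EFin \o F).
  apply/(@negligible_integrable _ (measurableTypeR R) R mu _ _ _ mN _ mF N0) => //.
  have iGN := iffLR (@negligible_integrable _ (measurableTypeR R) R mu _ _ _ mN
    (measurable_itv _) (measurable_int _ iG) N0) iG.
  apply: eq_integrable iGN; first exact: measurableD.
  by move=> x xD /=; rewrite FGN.
split => //; rewrite /Rintegral (@negligible_integral _ (measurableTypeR R) R mu _ _ _ mN _ iF N0)//.
rewrite (@negligible_integral _ (measurableTypeR R) R mu _ _ _ mN _ iG N0)//; congr fine.
by apply: eq_integral => x xD /=; rewrite FGN.
Qed.

Lemma integral_itv_cat (F : R -> R) (a b c : R) : a <= b -> b <= c ->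
  mu.-integrable `[a, b] (EFin \o F) -> mu.-integrable `[b, c] (EFin \o F) ->
  mu.-integrable `[a, c] (EFin \o F) /\
  \int[mu]_(x in `[a, c]) F x =
  \int[mu]_(x in `[a, b]) F x + \int[mu]_(x in `[b, c]) F x.
Proof.
move=> ab bc i1 i2.
have E : `[a, c]%classic = `[a, b] `|` `]b, c].
  by rewrite -itv_bndbnd_setU// bnd_simp.
have dis : [disjoint `[a, b]%classic & `]b, c]%classic].
  apply/disj_setPS => y [/=]; rewrite 2!in_itv/= => /andP[_ yb] /andP[].
  by rewrite ltNge yb.
have i2' : mu.-integrable `]b, c] (EFin \o F).
  by apply: integrableS i2 => //; exact: subset_itv_oc_cc.
have i : mu.-integrable `[a, c] (EFin \o F).
  rewrite E; apply/integrableP; split.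
    apply/measurable_funU => //.
    by split; [exact: measurable_int i1|exact: measurable_int i2'].
  rewrite ge0_integral_setU//; last first.
    apply: measurableT_comp => //; apply/measurable_funU => //.
    by split; [exact: measurable_int i1|exact: measurable_int i2'].
  by case/integrableP : i1 => _ ?; case/integrableP : i2' => _ ?; exact: lte_add_pinfty.
split=> //; rewrite E Rintegral_setU//; last by rewrite -E.
by rewrite (Rintegral_itv_obnd_cbnd i2').
Qed.

Lemma subdivision_le (L : nat -> R) m i j :
  (forall i : 'I_m, L i < L i.+1) -> (i <= j)%N -> (j <= m)%N -> L i <= L j.
Proof.
move=> ltL; elim: j => [|j IH]; first by rewrite leqn0 => /eqP ->.
rewrite leq_eqVlt => /predU1P[->//|ij] jm.
exact: le_trans (IH ij (ltnW jm)) (ltW (ltL (Ordinal jm))).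
Qed.

Lemma subdivision_lt (L : nat -> R) m i j :
  (forall i : 'I_m, L i < L i.+1) -> (i < j)%N -> (j <= m)%N -> L i < L j.
Proof.
move=> ltL ij jm; apply: lt_le_trans (subdivision_le ltL ij jm).
exact: (ltL (Ordinal (leq_trans ij jm))).
Qed.

Lemma integral_subdivision (L : nat -> R) m (F : R -> R) (G : 'I_m -> R -> R) :
  (forall i : 'I_m, L i < L i.+1) -> (forall i, continuous (G i)) ->
  (forall i : 'I_m, {in `]L i, L i.+1[, F =1 G i}) ->
  mu.-integrable `[L 0%N, L m] (EFin \o F) /\
  \int[mu]_(u in `[L 0%N, L m]) F u =
  \sum_(i < m) \int[mu]_(u in `[L i, L i.+1]) G i u.
Proof.
elim: m G => [|m IH] G ltL cG FG.
  rewrite set_itv1 big_ord0 Rintegral_set1; split=> //.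
  apply: null_set_integrable => //; last exact: lebesgue_measure_set1.
  by apply/measurable_EFinP; exact: measurable_fun_set1.
have [i1 E1] := IH (fun i => G (widen_ord (leqnSn m) i))
  (fun i => ltL (widen_ord (leqnSn m) i)) (fun i => cG _)
  (fun i => FG (widen_ord (leqnSn m) i)).
have [i2 E2] := integral_itv_open_eq (cG ord_max) (FG ord_max).
have L0 : L 0%N <= L m by exact: (subdivision_le ltL (leq0n m) (leqnSn m)).
have [i ->] := integral_itv_cat L0 (ltW (ltL ord_max)) i1 i2.
by split=> //; rewrite big_ord_recr/= E1 E2.
Qed.

Lemma continuous_subdivision (L : nat -> R) m (F : R -> R) (G : 'I_m -> R -> R) :
  (0 < m)%N ->
  (forall i : 'I_m, L i < L i.+1) -> (forall i, continuous (G i)) ->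
  (forall i : 'I_m, {in `[L i, L i.+1], F =1 G i}) ->
  {within `[L 0%N, L m], continuous F}.
Proof.
elim: m G => // m IH G _ ltL cG FG.
have c2 : {within `[L m, L m.+1], continuous F}.
  apply: (@subspace_eq_continuous _ _ _ (G ord_max)).
    by move=> u /set_mem /= uab; exact: (esym (FG ord_max u uab)).
  exact: continuous_subspaceT.
have [m0|m0] := posnP m; first by have -> : L 0%N = L m by rewrite m0.
have c1 := IH (fun i => G (widen_ord (leqnSn m) i)) m0
  (fun i => ltL (widen_ord (leqnSn m) i)) (fun i => cG _)
  (fun i => FG (widen_ord (leqnSn m) i)).
have L0 : L 0%N <= L m by exact: (subdivision_le ltL (leq0n m) (leqnSn m)).
have -> : `[L 0%N, L m.+1]%classic = `[L 0%N, L m] `|` `[L m, L m.+1].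
  apply/seteqP; split=> u /=; rewrite !in_itv/=.
    by move=> /andP[-> ->]; rewrite andbT; case: (leP u (L m)) => h; [left|right; exact: ltW].
  have lm := ltW (ltL ord_max).
  move=> [/andP[-> u1]|/andP[u1 ->]]; first exact: le_trans u1 lm.
  by rewrite (le_trans L0 u1).
by apply: withinU_continuous => //; exact: itv_closed.
Qed.

Lemma near_itv_eq (F G : R -> R) (a b u : R) : {in `]a, b[, F =1 G} ->
  u \in `]a, b[ -> \forall v \near u, F v = G v.
Proof.
move=> FG uab; have : nbhs u `]a, b[%classic by exact: near_in_itv.
by apply: filterS => v; exact: FG.
Qed.

Lemma derive1_itv_eq (F G : R -> R) (a b : R) : {in `]a, b[, F =1 G} ->
  {in `]a, b[, derive1 F =1 derive1 G}.
Proof.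
by move=> FG u uab; rewrite !derive1E; apply: near_eq_derive; exact: near_itv_eq FG uab.
Qed.

Lemma derivable_itv_eq (F G : R -> R) (a b : R) : {in `]a, b[, F =1 G} ->
  {in `]a, b[, forall u, derivable G u 1 -> derivable F u 1}.
Proof.
move=> FG u uab; apply: near_eq_derivable.
by apply: (near_itv_eq _ uab) => v vab; rewrite FG.
Qed.

Lemma derive1n_itv_eq (F G : R -> R) (a b : R) k : {in `]a, b[, F =1 G} ->
  {in `]a, b[, derive1n k F =1 derive1n k G}.
Proof.
move=> FG; elim: k => // k IH; rewrite !derive1nS; exact: derive1_itv_eq.
Qed.

(* A class of functions stable under differentiation that contains all the
   coordinates of the reparameterized curve. *)
Lemma smooth_sinusoid (A B C k b : R) :
  smooth (fun u => A * sin (k * u + b) + B * cos (k * u + b) + C).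
Proof.
have dE A' B' C' (u : R) : is_derive u 1
    (fun u => A' * sin (k * u + b) + B' * cos (k * u + b) + C')
    (- (B' * k) * sin (k * u + b) + A' * k * cos (k * u + b) + 0).
  have dl := is_derive_affine k b u.
  have ds : is_derive u 1 (fun u => sin (k * u + b)) (cos (k * u + b) * k).
    exact: (is_derive1_comp (is_derive_sin _) dl).
  have dc : is_derive u 1 (fun u => cos (k * u + b)) (- sin (k * u + b) * k).
    exact: (is_derive1_comp (is_derive_cos _) dl).
  have h := is_deriveD (is_deriveD (is_derive_mul (is_derive_cst A' u 1) ds)
    (is_derive_mul (is_derive_cst B' u 1) dc)) (is_derive_cst C' u 1).
  apply: (is_derive_eq h); rewrite /cst /=; ring.
have dn j : exists A' B' C', derive1n j (fun u => A * sin (k * u + b) + B * cos (k * u + b) + C)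
   = (fun u => A' * sin (k * u + b) + B' * cos (k * u + b) + C').
  elim: j => [|j [A' [B' [C' IH]]]]; first by exists A, B, C.
  exists (- (B' * k)), (A' * k), 0; rewrite derive1nS IH.
  exact: (is_derive_derive1 (dE A' B' C')).
move=> j u; have [A' [B' [C' ->]]] := dn j.
by have [] := dE A' B' C' u.
Qed.

End Subdivision.

(** * The curve *)

Section Curve.
Variables (R : realType) (n m : nat).
Variables (lam : n.+2.-tuple R -> R) (x : 'I_m -> n.+2.-tuple R).
Hypotheses (m_gt0 : (0 < m)%N) (m_even : ~~ odd m).
Hypotheses (lam_neq0 : forall i, lam (x i) != 0) (x_sphere : forall i, enorm (x i) = 1).
Hypothesis x_inj : injective x.
Local Notation L := (Lambda lam x).
Local Notation mu := (@lebesgue_measure R).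

(** * Breakpoints and gluing of the pieces *)

Let S : R := \sum_(j < m) `|lam (x j)|.

Lemma total_gt0 : 0 < S.
Proof.
rewrite /S (bigD1 (Ordinal m_gt0))//= ltr_pwDl ?normr_gt0//.
by apply: sumr_ge0.
Qed.

Lemma Lambda0 : L 0 = 0.
Proof. by rewrite /Lambda big_pred0 ?mul0r. Qed.

Lemma Lambda1 : L m = 1.
Proof.
rewrite /Lambda (eq_bigl xpredT); last by move=> j; rewrite ltn_ord.
by rewrite divff// gt_eqF// total_gt0.
Qed.

Lemma LambdaS (i : 'I_m) : L i.+1 - L i = `|lam (x i)| / S.
Proof.
rewrite /Lambda -mulrBl; congr (_ / _).
rewrite (bigD1 i)//= (eq_bigl (fun j : 'I_m => (j < i)%N)) ?addrK//.
move=> j; rewrite ltnS leq_eqVlt -val_eqE /=.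
by case: ltngtP.
Qed.

Lemma Lambda_lt (i : 'I_m) : L i < L i.+1.
Proof. by rewrite -subr_gt0 LambdaS divr_gt0 ?normr_gt0 ?total_gt0. Qed.

Definition width (i : 'I_m) : R := L i.+1 - L i.

Lemma width_gt0 i : 0 < width i.
Proof. by rewrite subr_gt0 Lambda_lt. Qed.

Lemma piece_exists s : 0 <= s <= 1 -> exists i : 'I_m, L i <= s <= L i.+1.
Proof.
have H k : (k <= m)%N -> L 0 <= s <= L k -> exists i : 'I_m, L i <= s <= L i.+1; last first.
  by rewrite -Lambda0 -Lambda1; exact: H.
elim: k => [|k IH] km /andP[s0 sk].
  exists (Ordinal m_gt0); rewrite s0 /= (le_trans sk)//.
  exact: ltW (Lambda_lt (Ordinal m_gt0)).
have [h|h] := leP s (L k); first by apply: IH; [exact: ltnW|rewrite s0].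
by exists (Ordinal km); rewrite (ltW h).
Qed.

Lemma piece_interior (i : 'I_m) s : s \in `]L i, L i.+1[ -> piece lam x s = Some i.
Proof.
rewrite in_itv/= => /andP[si si1]; rewrite /piece; case: pickP => [j /andP[sj sj1]|/(_ i)]; last first.
  by rewrite !ltW.
have [h|h|/val_inj -> //] := ltngtP i j.
  have := subdivision_le Lambda_lt h (ltnW (ltn_ord j)).
  by rewrite leNgt (le_lt_trans sj).
have := subdivision_le Lambda_lt h (ltnW (ltn_ord i)).
by rewrite leNgt (lt_le_trans si).
Qed.

(** At a breakpoint [pick] may return either neighbour, so a piecewise formula has the expected
    value as soon as neighbouring formulas agree there. If the selected piece is not [i], strict
    monotonicity of [L] forces it to be adjacent and s to be the shared breakpoint. *)
Lemma piece_glue T (h : 'I_m -> R -> T) dflt (i : 'I_m) s :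
  (forall i j : 'I_m, j = i.+1 :> nat -> h i (L j) = h j (L j)) ->
  s \in `[L i, L i.+1] ->
  (if piece lam x s is Some j then h j s else dflt) = h i s.
Proof.
move=> hE; rewrite in_itv/= => /andP[si si1].
rewrite /piece; case: pickP => [j /andP[sj sj1]|/(_ i)]; last by rewrite si si1.
have [ij|ji|/val_inj -> //] := ltngtP i j.
- have sE : s = L j.
    by apply/le_anti; rewrite sj andbT (le_trans si1)//; exact: (subdivision_le Lambda_lt ij (ltnW (ltn_ord j))).
  have jE : j = i.+1 :> nat.
    apply/eqP; rewrite eqn_leq ij andbT leqNgt; apply/negP => h'.
    have := subdivision_lt Lambda_lt h' (ltnW (ltn_ord j)).
    by rewrite ltNge -sE si1.
  by rewrite sE hE.
- have sE : s = L i.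
    by apply/le_anti; rewrite si andbT (le_trans sj1)//; exact: (subdivision_le Lambda_lt ji (ltnW (ltn_ord i))).
  have jE : i = j.+1 :> nat.
    apply/eqP; rewrite eqn_leq ji andbT leqNgt; apply/negP => h'.
    have := subdivision_lt Lambda_lt h' (ltnW (ltn_ord i)).
    by rewrite ltNge -sE sj1.
  by rewrite sE hE.
Qed.

Definition frac (i : 'I_m) (s : R) : R := (s - L i) / width i.

Lemma frac_left i : frac i (L i) = 0.
Proof. by rewrite /frac subrr mul0r. Qed.

Lemma frac_right (i : 'I_m) : frac i (L i.+1) = 1.
Proof. by rewrite /frac divff// gt_eqF// width_gt0. Qed.

Lemma frac_itv (i : 'I_m) s : s \in `[L i, L i.+1] -> 0 <= frac i s <= 1.
Proof.
have w0 := width_gt0 i.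
rewrite in_itv/= => /andP[si si1]; have d0 : 0 <= s - L i by rewrite subr_ge0.
rewrite /frac (divr_ge0 d0 (ltW w0))/=.
by rewrite ler_pdivrMr// mul1r lerD2r.
Qed.

Lemma frac_itvoo (i : 'I_m) s : s \in `]L i, L i.+1[ -> 0 < frac i s < 1.
Proof.
have w0 := width_gt0 i.
rewrite in_itv/= => /andP[si si1]; have d0 : 0 < s - L i by rewrite subr_gt0.
rewrite /frac (divr_gt0 d0 w0)/=.
by rewrite ltr_pdivrMr// mul1r ltrD2r.
Qed.

Lemma fracK (i : 'I_m) s : L i + width i * frac i s = s.
Proof. by rewrite /frac mulrC divfK ?subrKC// gt_eqF// width_gt0. Qed.

(** The alternating sign makes consecutive heights match: one piece ends at (-1)^i and the next
    starts at -(-1)^(i+1). *)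
Lemma alpha_lamE (i : 'I_m) s : s \in `[L i, L i.+1] ->
  alpha_lam lam x s = (-1) ^+ i * (2 * frac i s - 1).
Proof.
apply: (piece_glue (h := fun i s => (-1) ^+ i * (2 * frac i s - 1))) => {}i j ij.
by rewrite frac_left ij frac_right exprS; ring.
Qed.

Lemma alpha_XE (i : 'I_m) s : s \in `[L i, L i.+1] ->
  alpha_X lam x s = scale_tuple (Num.sqrt (1 - (2 * frac i s - 1) ^+ 2)) (x i).
Proof.
move=> si.
have -> : alpha_X lam x s = (if piece lam x s is Some j then
    scale_tuple (Num.sqrt (1 - (2 * frac j s - 1) ^+ 2)) (x j) else [tuple 0 | k < n.+2]).
  rewrite /alpha_X /alpha_lam; case: (piece lam x s) => // j.
  apply: eq_from_tnth => k; rewrite !tnth_mktuple; congr (Num.sqrt (1 - _) * _).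
  by rewrite exprMn sqrr_sign mul1r.
refine (@piece_glue _ (fun j s => scale_tuple
  (Num.sqrt (1 - (2 * frac j s - 1) ^+ 2)) (x j)) _ i s _ si) => {si}i j ij; apply: eq_from_tnth => k; rewrite !tnth_mktuple.
(* At a breakpoint the curve is at a pole: the radius is 0 and the points [x i] and [x j] no longer
   matter. *)
rewrite frac_left ij frac_right !(mulr0, sub0r, mulr1) sqrrN expr1n subrr sqrtr0.
by rewrite (_ : 2 - 1 = 1) ?expr1n ?subrr ?sqrtr0 ?mul0r//; ring.
Qed.

(** * The constant-speed parameterization *)

Definition angle (i : 'I_m) (u : R) : R := pi * frac i u.

Lemma angle_itv (i : 'I_m) u : u \in `[L i, L i.+1] -> 0 <= angle i u <= pi.
Proof.
move/frac_itv => /andP[f0 f1]; have pi0 := pi_gt0 R.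
rewrite /angle (mulr_ge0 (ltW pi0) f0)/= -[X in _ <= X]mulr1.
by rewrite (ler_pM2l pi0).
Qed.

Lemma angle_itvoo (i : 'I_m) u : u \in `]L i, L i.+1[ -> 0 < angle i u < pi.
Proof.
move/frac_itvoo => /andP[f0 f1]; have pi0 := pi_gt0 R.
rewrite /angle (mulr_gt0 pi0 f0)/= -[X in _ < X]mulr1.
by rewrite (ltr_pM2l pi0).
Qed.

Lemma angle_left i : angle i (L i) = 0.
Proof. by rewrite /angle frac_left mulr0. Qed.

Lemma angle_right (i : 'I_m) : angle i (L i.+1) = pi.
Proof. by rewrite /angle frac_right mulr1. Qed.

(* The reparameterization turns each piece of the curve into a meridian
   traversed at constant speed. *)
Definition repar (u : R) : R :=
  if piece lam x u is Some i then L i + width i * ((1 - cos (angle i u)) / 2) else 0.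

Lemma reparE (i : 'I_m) u : u \in `[L i, L i.+1] ->
  repar u = L i + width i * ((1 - cos (angle i u)) / 2).
Proof.
apply: (piece_glue (h := fun i u => L i + width i * ((1 - cos (angle i u)) / 2))) => {}i j ij.
rewrite angle_left ij angle_right cos0 cospi subrr mul0r mulr0 addr0.
rewrite (_ : (1 - - 1) / 2 = 1 :> R); last by field.
by rewrite mulr1 /width addrC subrK.
Qed.

Lemma frac_repar (i : 'I_m) u : u \in `[L i, L i.+1] ->
  frac i (repar u) = (1 - cos (angle i u)) / 2.
Proof.
move=> ui; rewrite (reparE ui) /frac addrC addKr mulrC mulKf// gt_eqF//.
exact: width_gt0.
Qed.

Lemma repar_itv (i : 'I_m) u : u \in `[L i, L i.+1] -> repar u \in `[L i, L i.+1].
Proof.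
move=> ui; rewrite (reparE ui) in_itv/=; have w0 := width_gt0 i.
have := cos_geN1 (angle i u); have := cos_le1 (angle i u) => c1 c2.
rewrite lerDl mulr_ge0 ?(ltW w0) ?divr_ge0 ?subr_ge0//=.
by rewrite -lerBrDl -[leRHS]mulr1 ler_pM2l// ler_pdivrMr// mul1r; lra.
Qed.

Lemma cos_itvoo (th : R) : 0 < th < pi -> -1 < cos th < 1.
Proof.
move=> /andP[t0 tp]; have pi0 := pi_ge0 R.
have tI : th \in `[0, pi] by rewrite in_itv/= !ltW.
have zI : 0 \in `[0, pi : R] by rewrite in_itv/= lexx.
have pI : pi \in `[0, pi : R] by rewrite in_itv/= lexx pi0.
apply/andP; split; first by rewrite -[X in X < _]cospi ltr_cos.
by rewrite -[X in _ < X]cos0 ltr_cos.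
Qed.

Lemma repar_itvoo (i : 'I_m) u : u \in `]L i, L i.+1[ -> repar u \in `]L i, L i.+1[.
Proof.
move=> ui; rewrite (reparE (subset_itv_oo_cc ui)) in_itv/=; have w0 := width_gt0 i.
have /andP[c1 c2] := cos_itvoo (angle_itvoo ui).
have h0 : 0 < (1 - cos (angle i u)) / 2 by lra.
rewrite ltrDl (mulr_gt0 w0 h0)/= -ltrBrDl -[X in _ < X]mulr1 (ltr_pM2l w0).
lra.
Qed.

(** [c] and [s] stand for a cosine and a sine. Keeping the pair instead of the angle makes the point
    linear in it, so that velocities are multiples of arcs too. The sign is (-1)^(i+1) because the
    height is (-1)^i times -cos. *)
Definition arc (i : 'I_m) (c s : R) : n.+3.-tuple R :=
  [tuple of rcons (scale_tuple s (x i)) ((-1) ^+ (~~ odd i) * c)].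

Lemma tnth_arc i c s k :
  tnth (arc i c s) k = s * tnth (arc i 0 1) k + c * tnth (arc i 1 0) k.
Proof.
have E (y : n.+2.-tuple R) z : tnth [tuple of rcons y z] k =
    if ltnP k n.+2 is LtnNotGeq kn then tnth y (Ordinal kn) else z.
  rewrite (tnth_nth 0) /= nth_rcons size_tuple.
  case: ltnP => [kn|kn]; first by rewrite (tnth_nth 0).
  by rewrite eqn_leq kn -ltnS ltn_ord.
by rewrite !E; case: ltnP => kn; rewrite ?tnth_mktuple; ring.
Qed.

Lemma sqr_enorm_arc i c s : enorm (arc i c s) ^+ 2 = s ^+ 2 + c ^+ 2.
Proof.
rewrite sqr_enorm_rcons enorm_scale_tuple x_sphere mulr1 real_normK ?num_real//.
by rewrite exprMn sqrr_sign mul1r.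
Qed.

Local Notation gamma := (alpha_X_lam lam x).

Lemma gammaE (i : 'I_m) s : s \in `[L i, L i.+1] ->
  gamma s = arc i (- (2 * frac i s - 1)) (Num.sqrt (1 - (2 * frac i s - 1) ^+ 2)).
Proof.
move=> si; apply/val_inj; rewrite /= (alpha_lamE si) (alpha_XE si); congr rcons.
by rewrite -signr_odd; case: (odd i); rewrite /= ?expr0 ?expr1; ring.
Qed.

Lemma gamma_repar (i : 'I_m) u : u \in `[L i, L i.+1] -> gamma (repar u) = arc i (cos (angle i u)) (sin (angle i u)).
Proof.
move=> ui; have ri := repar_itv ui.
rewrite (gammaE ri).
have -> : 2 * frac i (repar u) - 1 = - cos (angle i u).
  by rewrite (frac_repar ui); field.
rewrite opprK sqrrN -sin2cos2 sqrtr_sqr ger0_norm//.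
by apply: sin_ge0_pi; exact: angle_itv.
Qed.

(** Each piece leads from one pole to the other, so after an even number of them the curve is back
    at its starting pole, the one of height -1. *)
Lemma gamma_closed : gamma (repar 0) = gamma (repar 1).
Proof.
have last_lt : (m.-1 < m)%N by rewrite prednK.
pose i0 := Ordinal m_gt0; pose i1 := Ordinal last_lt.
have E0 : L i0 = 0 := Lambda0.
have E1 : L i1.+1 = 1 by rewrite /= prednK// Lambda1.
have u0 : L i0 \in `[L i0, L i0.+1] by rewrite in_itv/= lexx (ltW (Lambda_lt i0)).
have u1 : L i1.+1 \in `[L i1, L i1.+1] by rewrite in_itv/= lexx (ltW (Lambda_lt i1)).
rewrite -[X in _ (repar X) = _]E0 -[X in _ = _ (repar X)]E1.
rewrite (gamma_repar u0) (gamma_repar u1) angle_left angle_right.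
have odd1 : odd m.-1 by move: m_even; rewrite -{1}(prednK m_gt0) /= negbK.
have z i : scale_tuple 0 (x i) = [tuple 0 | k < n.+2].
  by apply: eq_from_tnth => k; rewrite !tnth_mktuple mul0r.
rewrite /arc sin0 sinpi cos0 cospi !z; apply/val_inj => /=.
by rewrite odd1 /= mulr1 mul1r expr1.
Qed.

Definition rate (i : 'I_m) : R := pi / width i.

Lemma rate_gt0 i : 0 < rate i.
Proof. by apply: divr_gt0; [exact: pi_gt0|exact: width_gt0]. Qed.

Lemma angleE i u : angle i u = rate i * u + - (rate i * L i).
Proof. by rewrite /angle /frac /rate; ring. Qed.

Lemma is_derive_angle i (u : R) : is_derive u 1 (angle i) (rate i).
Proof.
rewrite (_ : angle i = (fun u => rate i * u + - (rate i * L i))).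
  exact: is_derive_affine.
by apply/funext => v; exact: angleE.
Qed.

(** * Regularity of the reparameterized curve *)

Let subdiv := mkseq (fun i => L i.+1) m.

Lemma subdiv_left i : (i < size subdiv)%N -> nth 0 (0 :: subdiv) i = L i.
Proof.
rewrite size_mkseq => im; case: i im => [|i] im; first by rewrite Lambda0.
by rewrite /= nth_mkseq// ltnW.
Qed.

Lemma subdiv_right i : (i < size subdiv)%N -> nth 0 subdiv i = L i.+1.
Proof. by rewrite size_mkseq => im; rewrite nth_mkseq. Qed.

Lemma subdiv_partition : itv_partition 0 1 subdiv.
Proof.
split.
  apply/(pathP 0) => i im; rewrite subdiv_left// subdiv_right//.
  by rewrite size_mkseq in im; exact: (Lambda_lt (Ordinal im)).
by rewrite -nth_last size_mkseq subdiv_right ?size_mkseq prednK// Lambda1.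
Qed.

Lemma piece_exists_itv u : u \in `[0, 1] -> exists i : 'I_m, u \in `[L i, L i.+1].
Proof. by rewrite in_itv/= => /piece_exists[i ui]; exists i; rewrite in_itv. Qed.

Lemma gamma_repar_sphere : {in `[0, 1], forall u, sphere (gamma (repar u))}.
Proof.
move=> u /piece_exists_itv[i ui]; rewrite /sphere/= (gamma_repar ui).
apply/eqP; rewrite -(@eqrXn2 _ 2) ?enorm_ge0// sqr_enorm_arc expr1n.
by rewrite addrC cos2Dsin2.
Qed.

(** Written in the exact shape of [smooth_sinusoid], including the zero constant term. *)
Definition arc_coord (i : 'I_m) k (u : R) :=
  tnth (arc i 0 1) k * sin (rate i * u + - (rate i * L i)) +
  tnth (arc i 1 0) k * cos (rate i * u + - (rate i * L i)) + 0.

Lemma gamma_repar_coord k (i : 'I_m) :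
  {in `[L i, L i.+1], (fun u => tnth (gamma (repar u)) k) =1 arc_coord i k}.
Proof.
move=> u ui; rewrite (gamma_repar ui) tnth_arc /arc_coord -angleE addr0.
by rewrite mulrC [X in _ + X]mulrC.
Qed.

Lemma smooth_continuous (g : R -> R) : smooth g -> continuous g.
Proof.
move=> sg u; apply/differentiable_continuous/derivable1_diffP.
exact: (sg 0%N u).
Qed.

Lemma gamma_repar_continuous k :
  {within `[0, 1], continuous (fun u => tnth (gamma (repar u)) k)}.
Proof.
have := continuous_subdivision m_gt0 Lambda_lt _ (gamma_repar_coord k).
rewrite Lambda0 Lambda1; apply => i.
exact: smooth_continuous (@smooth_sinusoid _ _ _ _ _ _).
Qed.

Lemma gamma_repar_piecewise_smooth : piecewise_smooth (gamma \o repar).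
Proof.
exists subdiv; first exact: subdiv_partition.
move=> i im k; rewrite subdiv_left// subdiv_right//.
rewrite size_mkseq in im.
exists (arc_coord (Ordinal im) k); first exact: smooth_sinusoid.
exact: (@gamma_repar_coord k (Ordinal im)).
Qed.

Lemma repar_sinusoid (i : 'I_m) : {in `[L i, L i.+1], repar =1
  (fun u => 0 * sin (rate i * u + - (rate i * L i)) +
    - (width i / 2) * cos (rate i * u + - (rate i * L i)) + (L i + width i / 2))}.
Proof. by move=> u ui; rewrite (reparE ui) -angleE; field. Qed.

Lemma repar_left (i : 'I_m) : repar (L i) = L i.
Proof.
rewrite (@reparE i); first by rewrite angle_left cos0 subrr mul0r mulr0 addr0.
by rewrite in_itv/= lexx (ltW (Lambda_lt i)).
Qed.

Lemma repar_right (i : 'I_m) : repar (L i.+1) = L i.+1.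
Proof.
rewrite (@reparE i); last by rewrite in_itv/= lexx (ltW (Lambda_lt i)).
rewrite angle_right cospi (_ : (1 - - 1) / 2 = 1 :> R); last by field.
by rewrite mulr1 /width addrC subrK.
Qed.

Lemma repar_lt_piece (i : 'I_m) u v : u \in `[L i, L i.+1] -> v \in `[L i, L i.+1] ->
  u < v -> repar u < repar v.
Proof.
move=> ui vi uv; rewrite (reparE ui) (reparE vi) ltrD2l (ltr_pM2l (width_gt0 i)).
rewrite ltr_pM2r ?invr_gt0// ltrD2l ltrN2 ltr_cos ?in_itv/=.
- by rewrite !angleE ltrD2r (ltr_pM2l (rate_gt0 i)).
- exact: angle_itv.
- exact: angle_itv.
Qed.

(** On one piece cos is decreasing. Points of different pieces are compared through the breakpoints
    between them, which [repar] fixes. *)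
Lemma repar_increasing : {in `[0, 1] &, {homo repar : u v / u < v}}.
Proof.
move=> u v /piece_exists_itv[i ui] /piece_exists_itv[j vj] uv.
have := ui; rewrite in_itv/= => /andP[iu ui1].
have := vj; rewrite in_itv/= => /andP[jv vj1].
have ir : L i.+1 \in `[L i, L i.+1] by rewrite in_itv/= lexx (ltW (Lambda_lt i)).
have jl : L j \in `[L j, L j.+1] by rewrite in_itv/= lexx (ltW (Lambda_lt j)).
have [ij|ji|/val_inj ij] := ltngtP i j; last 2 first.
- have := subdivision_le Lambda_lt ji (ltnW (ltn_ord i)).
  by rewrite leNgt (le_lt_trans iu (lt_le_trans uv vj1)).
- by move: ui; rewrite ij => uj; exact: repar_lt_piece uj vj uv.
have h := subdivision_le Lambda_lt ij (ltnW (ltn_ord j)).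
have h1 : repar u <= L i.+1 by have := repar_itv ui; rewrite in_itv/= => /andP[].
have h2 : L j <= repar v by have := repar_itv vj; rewrite in_itv/= => /andP[].
have [ul|ul|ue] := ltgtP u (L i.+1); last 2 first.
- by move: ui1; rewrite leNgt ul.
- have {}jv : L j < v \/ L j = v by move: jv; rewrite le_eqVlt => /predU1P; tauto.
  case: jv => [jv|jv].
    rewrite (le_lt_trans h1)// (le_lt_trans h)// -(repar_left j).
    exact: repar_lt_piece jl vj jv.
  (* Both points are breakpoints, so [repar] leaves them in place. *)
  rewrite ue repar_right -jv repar_left lt_neqAle h andbT.
  by apply/eqP => e; move: uv; rewrite ue e jv ltxx.
rewrite (lt_le_trans _ h2)// (lt_le_trans _ h)// -(repar_right i).
exact: repar_lt_piece ui ir ul.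
Qed.

Lemma repar_reparameterization : reparameterization repar.
Proof.
have last_lt : (m.-1 < m)%N by rewrite prednK.
split.
- by rewrite -{1}Lambda0 (repar_left (Ordinal m_gt0)) Lambda0.
- by have := repar_right (Ordinal last_lt); rewrite /= prednK// Lambda1.
- have := continuous_subdivision m_gt0 Lambda_lt _ repar_sinusoid.
  rewrite Lambda0 Lambda1; apply => i.
  exact: smooth_continuous (@smooth_sinusoid _ _ _ _ _ _).
- exact: repar_increasing.
exists subdiv; first exact: subdiv_partition.
move=> k km; rewrite subdiv_left// subdiv_right//.
rewrite size_mkseq in km; move=> u uk; pose i := Ordinal km.
have E := sub_in1 (@subset_itv_oo_cc _ _ (L i) (L i.+1)) (repar_sinusoid (i := i)).
split.
  move=> j; apply: (derivable_itv_eq (derive1n_itv_eq j E) uk).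
  exact: smooth_sinusoid.
have E' : {in `]L i, L i.+1[, repar =1 (fun u => L i + width i / 2 + - (width i / 2) * cos (angle i u))}.
  by move=> v vi; rewrite (reparE (subset_itv_oo_cc vi)); field.
rewrite (derive1_itv_eq E' uk).
have d : is_derive u 1 (fun u => L i + width i / 2 + - (width i / 2) * cos (angle i u))
   (width i / 2 * (sin (angle i u) * rate i)).
  have dc := is_derive1_comp (is_derive_cos (angle i u)) (is_derive_angle i u).
  have := is_deriveD (is_derive_cst (L i + width i / 2) u 1)
    (is_derive_mul (is_derive_cst (- (width i / 2)) u 1) dc).
  move/is_derive_eq; apply; rewrite /cst /=; ring.
have [_] := d; rewrite derive1E => ->.
apply: mulr_gt0; first exact: divr_gt0 (width_gt0 i) _.
by apply: mulr_gt0 (rate_gt0 i); apply: sin_gt0_pi; exact: (@angle_itvoo i u uk).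
Qed.

Lemma sin_angle_neq0 (i : 'I_m) u : u \in `[L i, L i.+1] -> sin (angle i u) = 0 ->
  u = L i \/ u = L i.+1.
Proof.
rewrite in_itv/= => /andP[iu ui]; case: ltgtP iu => // [iu|<-] _ s0; last by left.
case: ltgtP ui => // [ui|->] _; last by right.
have uI : u \in `]L i, L i.+1[ by rewrite in_itv/= iu.
by have := sin_gt0_pi (angle_itvoo uI); rewrite s0 ltxx.
Qed.

(** A double point can only be a pole. Elsewhere the horizontal part has norm sin th > 0, which
    determines the sine, hence [x i], hence i by injectivity; the height then determines the angle.
    Poles occur only at breakpoints, so all pairs lie in [B] times [B]. *)
Lemma finite_self_intersections : finite_set (self_intersections (gamma \o repar)).
Proof.
pose B : set R := L @` `I_m.+1.
have fB : finite_set B by apply: finite_image; exact: finite_II.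
have BP (i : 'I_m) u : u \in `[L i, L i.+1] -> sin (angle i u) = 0 -> B u.
  move=> ui /(sin_angle_neq0 ui)[->|->]; first by exists i => //=; exact: ltnW (ltn_ord i).
  by exists i.+1 => //=; exact: (ltn_ord i).
apply: (@sub_finite_set _ _ (B `*` B)); last exact: finite_setX.
move=> [u v] [/= /piece_exists_itv[i ui] /piece_exists_itv[j vj] uv].
rewrite (gamma_repar ui) (gamma_repar vj).
move: (angle_itv ui) (angle_itv vj) => au av E.
have /(congr1 (fun l => last 0 l)) Ec := congr1 val E.
rewrite /= !last_rcons in Ec.
have Es : scale_tuple (sin (angle i u)) (x i) = scale_tuple (sin (angle j v)) (x j).
  by apply/val_inj; have /rcons_inj[] := congr1 val E.
have ss : sin (angle i u) = sin (angle j v).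
  have := congr1 (@enorm R _) Es; rewrite !enorm_scale_tuple !x_sphere !mulr1.
  by rewrite !ger0_norm// sin_ge0_pi.
have [s0|s0] := eqVneq (sin (angle i u)) 0.
  by split; [exact: BP ui s0|apply: (BP _ _ vj); rewrite -ss].
have ij : i = j.
  apply: x_inj; apply: eq_from_tnth => k.
  have := congr1 (fun y => tnth y k) Es; rewrite !tnth_mktuple -ss.
  exact: mulfI.
exfalso; move: Ec uv; rewrite -{}ij in vj av ss *.
have sg0 : (-1) ^+ (~~ odd i) != 0 :> R by rewrite signr_eq0.
move/(mulfI sg0) => cc uv.
have auv : angle i u = angle i v by apply: cos_inj => //; rewrite in_itv.
move: uv; rewrite -[X in X < _](fracK i u) -[X in _ < X](fracK i v).
have -> : frac i u = frac i v by apply: (mulfI _ auv); rewrite gt_eqF ?pi_gt0.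
by rewrite ltxx.
Qed.

(** * Speeds and the weighted integrand *)

Lemma derive_gamma_repar (i : 'I_m) u k : u \in `]L i, L i.+1[ ->
  derive1 (fun v => tnth (gamma (repar v)) k) u =
  tnth (scale_tuple (rate i) (arc i (- sin (angle i u)) (cos (angle i u)))) k.
Proof.
move=> ui.
have E : {in `]L i, L i.+1[, (fun v => tnth (gamma (repar v)) k) =1
    (fun v => tnth (arc i 0 1) k * sin (angle i v) + tnth (arc i 1 0) k * cos (angle i v))}.
  by move=> v vi; rewrite (gamma_repar_coord _ (subset_itv_oo_cc vi)) /arc_coord addr0 -angleE.
rewrite (derive1_itv_eq E ui) derive1E.
have da := is_derive_angle i u.
have ds := is_derive1_comp (is_derive_sin (angle i u)) da.
have dc := is_derive1_comp (is_derive_cos (angle i u)) da.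
have [_] := is_deriveD (is_derive_mul (is_derive_cst (tnth (arc i 0 1) k) u 1) ds)
  (is_derive_mul (is_derive_cst (tnth (arc i 1 0) k) u 1) dc).
rewrite [X in derive X _ _](_ : _ =
  (fun v => tnth (arc i 0 1) k * sin (angle i v) + tnth (arc i 1 0) k * cos (angle i v)))// => ->.
by rewrite tnth_mktuple (tnth_arc i (- sin _)) /cst /=; ring.
Qed.

Lemma speed_gamma_repar (i : 'I_m) u : u \in `]L i, L i.+1[ ->
  speed (gamma \o repar) u = rate i.
Proof.
move=> ui; rewrite /speed.
have -> : [tuple derive1 (fun v => tnth ((gamma \o repar) v) k) u | k < n.+3] =
    scale_tuple (rate i) (arc i (- sin (angle i u)) (cos (angle i u))).
  by apply: eq_from_tnth => k; rewrite tnth_mktuple; exact: derive_gamma_repar.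
rewrite enorm_scale_tuple gtr0_norm ?rate_gt0// [X in _ * X](_ : _ = 1) ?mulr1//.
apply/eqP; rewrite -(@eqrXn2 _ 2) ?enorm_ge0// sqr_enorm_arc expr1n sqrrN.
by rewrite cos2Dsin2.
Qed.

(** The height without its sign (-1)^i, which disappears in the square and is restored by [arc]. *)
Definition height (i : 'I_m) (s : R) : R := 2 * frac i s - 1.

Lemma height_itvoo (i : 'I_m) s : s \in `]L i, L i.+1[ -> 0 < 1 - height i s ^+ 2.
Proof.
move=> /frac_itvoo; rewrite /height; move: (frac i s) => f /andP[f0 f1].
by rewrite (_ : 1 - _ = 4 * f * (1 - f)); [nra|ring].
Qed.

(** Write h for the height and r = sqrt(1 - h^2), so h' = 2 / width and r' = -h h' / r. Factoring h'
    / r out of the velocity leaves the arc with entries -r and -h, a unit vector. *)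
Lemma is_derive_gamma (i : 'I_m) (s : R) k : s \in `]L i, L i.+1[ ->
  is_derive s 1 (fun v => tnth (arc i (- height i v) (Num.sqrt (1 - height i v ^+ 2))) k)
  (tnth (scale_tuple (2 / (width i * Num.sqrt (1 - height i s ^+ 2)))
     (arc i (- Num.sqrt (1 - height i s ^+ 2)) (- height i s))) k).
Proof.
move=> si; have h0 := height_itvoo si; have w0 := width_gt0 i.
have r0 : 0 < Num.sqrt (1 - height i s ^+ 2) by rewrite sqrtr_gt0.
have dh : is_derive s 1 (height i) (2 / width i).
  rewrite (_ : height i = (fun v => 2 / width i * v + - (2 * (L i / width i) + 1))).
    exact: is_derive_affine.
  by apply/funext => v; rewrite /height /frac; ring.
have dq : is_derive s 1 (fun v => 1 - height i v ^+ 2) _ :=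
  is_deriveB (is_derive_cst (1 : R) s 1) (is_derive_exp 1 dh).
have dr : is_derive s 1 (fun v => Num.sqrt (1 - height i v ^+ 2)) _ :=
  @is_derive1_comp _ Num.sqrt (fun v => 1 - height i v ^+ 2) s _ _ (is_derive1_sqrt h0) dq.
have := is_deriveD (is_derive_mul dr (is_derive_cst (tnth (arc i 0 1) k) s 1))
  (is_derive_mul (is_deriveN dh) (is_derive_cst (tnth (arc i 1 0) k) s 1)).
rewrite [X in is_derive _ _ X _ -> _](_ : _ =
  (fun v => tnth (arc i (- height i v) (Num.sqrt (1 - height i v ^+ 2))) k)).
  move/is_derive_eq; apply; rewrite tnth_mktuple (tnth_arc i (- Num.sqrt _)) /cst /= !mulr0 !add0r expr1.
  field.
  by rewrite !gt_eqF.
by apply/funext => v; rewrite [RHS]tnth_arc.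
Qed.

Lemma gamma_coord_itvoo (i : 'I_m) k : {in `]L i, L i.+1[, (fun v => tnth (gamma v) k) =1
  (fun v => tnth (arc i (- height i v) (Num.sqrt (1 - height i v ^+ 2))) k)}.
Proof. by move=> v vi; rewrite (gammaE (subset_itv_oo_cc vi)). Qed.

Lemma derivable_gamma (i : 'I_m) s k : s \in `]L i, L i.+1[ ->
  derivable (fun v => tnth (gamma v) k) s 1.
Proof.
move=> si; apply: (derivable_itv_eq (gamma_coord_itvoo (i := i) k) si).
by have [] := is_derive_gamma k si.
Qed.

Lemma speed_gamma (i : 'I_m) s : s \in `]L i, L i.+1[ ->
  speed gamma s = 2 / (width i * Num.sqrt (1 - height i s ^+ 2)).
Proof.
move=> si; have h0 := height_itvoo si; have w0 := width_gt0 i.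
have r0 : 0 < Num.sqrt (1 - height i s ^+ 2) by rewrite sqrtr_gt0.
rewrite /speed.
have -> : [tuple derive1 (fun v => tnth (gamma v) k) s | k < n.+3] =
    (scale_tuple (2 / (width i * Num.sqrt (1 - height i s ^+ 2)))
     (arc i (- Num.sqrt (1 - height i s ^+ 2)) (- height i s))).
  apply: eq_from_tnth => k; rewrite [LHS]tnth_mktuple.
  rewrite (derive1_itv_eq (gamma_coord_itvoo (i := i) k) si) derive1E.
  by have [_] := is_derive_gamma k si.
rewrite enorm_scale_tuple ger0_norm ?divr_ge0 ?mulr_ge0 ?(ltW w0) ?(ltW r0)//.
rewrite [X in _ * X](_ : _ = 1) ?mulr1//.
apply/eqP; rewrite -(@eqrXn2 _ 2) ?enorm_ge0// sqr_enorm_arc expr1n !sqrrN.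
by rewrite sqr_sqrtr ?(ltW h0)// subrKC.
Qed.

Lemma height_repar (i : 'I_m) u : u \in `[L i, L i.+1] -> height i (repar u) = - cos (angle i u).
Proof. by move=> ui; rewrite /height (frac_repar ui); field. Qed.

(** At [repar u] the radius is sin th. Dividing by the original speed 2 / (width sin th) cancels the
    factor 2 and the width in [ell], and raises sin^n to the sin^(n+1) of [meridian]; the new speed
    contributes [rate i]. *)
Lemma curve_integrand f (p : mpoly.mpoly n.+3 R) (i : 'I_m) :
  {in @sphere R n.+3, forall y, f y = mpoly.meval (tnth y) p} ->
  {in `]L i, L i.+1[, (fun u => f (gamma (repar u)) * w_X_lam lam x (repar u) *
      speed (gamma \o repar) u) =1
    (fun u => lam (x i) * volume_ratio R n.+2 * rate i *
      meridian p (~~ odd i) (x i) (pi * ((u - L i) / (L i.+1 - L i))))}.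
Proof.
move=> fp u ui; have uc := subset_itv_oo_cc ui; have ri := repar_itvoo ui.
have rc := subset_itv_oo_cc ri; have w0 := width_gt0 i.
have s0 : 0 < sin (angle i u) by apply: sin_gt0_pi; exact: angle_itvoo.
have q : 1 - height i (repar u) ^+ 2 = sin (angle i u) ^+ 2.
  by rewrite (height_repar uc) sqrrN sin2cos2.
have u01 : u \in `[0, 1].
  move: uc; rewrite !in_itv/= => /andP[a b]; apply/andP; split.
    apply: le_trans a; rewrite -Lambda0.
    exact: (subdivision_le Lambda_lt (leq0n i) (ltnW (ltn_ord i))).
  apply: le_trans b _; rewrite -Lambda1.
  exact: (subdivision_le Lambda_lt (ltn_ord i) (leqnn m)).
rewrite (speed_gamma_repar ui) fp; last by apply/mem_set; exact: gamma_repar_sphere.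
rewrite (gamma_repar uc) /w_X_lam (speed_gamma ri) (alpha_lamE rc) q.
rewrite exprMn sqrr_sign mul1r -/(height i (repar u)) q /ell (piece_interior ri).
rewrite sqrtr_sqr gtr0_norm// -/(width i).
rewrite -/(frac i u) -/(angle i u) /meridian -/(arc i (cos (angle i u)) (sin (angle i u))).
(* Here d = n + 2, so the exponent (d - 2) / 2 is n / 2. *)
have -> : (sin (angle i u) ^+ 2) `^ ((n.+2%:R - 2) / 2) = sin (angle i u) ^+ n.
  rewrite -[_ ^+ 2]powR_mulrn ?(ltW s0)// -powRrM.
  rewrite (_ : 2%:R * _ = n%:R) ?powR_mulrn ?(ltW s0)//.
  have -> : n.+2%:R = n%:R + 2 :> R by rewrite -addn2 natrD.
  by field.
rewrite exprS /rate; move: (mpoly.meval _ _) => P; field.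
by rewrite !gt_eqF.
Qed.

Lemma speed_gamma_unbounded : speed_unbounded gamma.
Proof.
move=> [M HM]; pose i := Ordinal m_gt0; have w0 := width_gt0 i.
pose K := `|M| + 1; have K0 : 0 < K by rewrite ltr_wpDl.
have wK : 0 < width i * K by rewrite mulr_gt0.
(* At the fraction e^2 of the first piece the radius is 2 e sqrt(1 - e^2) <= 2 e, so the speed is at
   least 1 / (width e) >= K > M. The bound 1/2 keeps the point inside the piece. *)
pose e := Num.min 2^-1 (width i * K)^-1.
have e0 : 0 < e by rewrite lt_min !invr_gt0 wK ltr0n.
have e1 : e <= 2^-1 by rewrite ge_min lexx.
have e2 : e <= (width i * K)^-1 by rewrite ge_min lexx orbT.
pose s := L i + width i * e ^+ 2.
have fs : frac i s = e ^+ 2 by rewrite /frac /s addrC addKr mulrC mulKf// gt_eqF.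
have esq : 0 < e ^+ 2 < 1 by rewrite exprn_gt0// expr_lt1// ?(ltW e0)//; lra.
have si : s \in `]L i, L i.+1[.
  rewrite in_itv/= /s ltrDl (mulr_gt0 w0) ?exprn_gt0//= -ltrBrDl -[X in _ < X]mulr1.
  by rewrite (ltr_pM2l w0); case/andP: esq.
have s01 : s \in `]0, 1[.
  move: si; rewrite !in_itv/= {1}Lambda0 => /andP[-> h] /=.
  by apply: lt_le_trans h _; rewrite -Lambda1; exact: (subdivision_le Lambda_lt m_gt0 (leqnn m)).
have h0 := height_itvoo si.
have r0 : 0 < Num.sqrt (1 - height i s ^+ 2) by rewrite sqrtr_gt0.
have r1 : Num.sqrt (1 - height i s ^+ 2) <= 2 * e.
  rewrite -(@ler_pXn2r _ 2) ?nnegrE ?(ltW r0) ?mulr_ge0 ?(ltW e0)// sqr_sqrtr ?(ltW h0)//.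
  by rewrite /height fs; case/andP: esq; nra.
have := HM s s01 (fun k => @derivable_gamma i s k si).
rewrite (speed_gamma si) leNgt => /negP; apply.
have MK : M < K by rewrite /K ltr_pwDr// ler_norm.
apply: lt_le_trans MK _.
rewrite ler_pdivlMr ?mulr_gt0//.
have e2' : width i * K * e <= 1 by rewrite -(@mulfV _ (width i * K)) ?gt_eqF// ler_pM2l.
apply: le_trans (_ : 2 * (width i * K * e) <= _); last by lra.
rewrite mulrCA [leRHS](_ : _ = width i * (K * (2 * e))); last by ring.
by rewrite ler_pM2l// ler_pM2l.
Qed.

End Curve.

Theorem proposition5p2 (R : realType) (d t N : nat)
    (X : {fset d.-tuple R}) (lam : d.-tuple R -> R)
    (x : 'I_(2 * N) -> d.-tuple R) :
  (2 <= d)%N ->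
  weighted_design_set t X lam ->
  #|` X| = (2 * N)%N ->
  injective x -> X =i codom x ->
  weighted_design_curve t (alpha_X_lam lam x) (w_X_lam lam x).
Proof.
case: d X lam x => [//|[//|n]] X lam x _ des _ x_inj X_x.
have [XS lam0 _] := des.
have m0 : (0 < 2 * N)%N := design_gt0 des x_inj X_x.
have m_even : ~~ odd (2 * N) by rewrite oddM.
have xX i : x i \in X by rewrite X_x codom_f.
have xS i : enorm (x i) = 1 := XS _ (xX i).
have l0 i : lam (x i) != 0 := lam0 _ (xX i).
right; split; first exact: (speed_gamma_unbounded m0 l0 xS).
exists (repar lam x); first exact: (repar_reparameterization m0 l0).
split.
- split; first exact: (gamma_repar_sphere m0 l0 xS).
  exact: (gamma_repar_continuous m0 l0).
- exact: (gamma_repar_piecewise_smooth m0 l0).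
- exact: (gamma_closed m0 m_even l0).
- exact: (finite_self_intersections m0 l0 xS x_inj).
move=> f [p pt fp] F.
pose L := Lambda lam x.
have Llt := Lambda_lt m0 l0.
pose C i := lam (x i) * volume_ratio R n.+2 * rate lam x i.
(* [G i] is the continuous extension to the whole line of the integrand on the open i-th piece. *)
pose G (i : 'I_(2 * N)) u := C i * meridian p (~~ odd i) (x i) (pi * ((u - L i) / (L i.+1 - L i))).
have cM (i : 'I_(2 * N)) : continuous (fun u => meridian p (~~ odd i) (x i) (pi * ((u - L i) / (L i.+1 - L i)))).
  move=> u.
  apply: (@continuous_comp _ _ _ (angle lam x i) (meridian p (~~ odd i) (x i)));
    last exact: continuous_meridian.
  exact: (is_derive_continuous (is_derive_angle lam x i)).
have cG i : continuous (G i) by exact: continuous_funZ (cM i).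
have [] := integral_subdivision Llt cG (fun i : 'I_(2 * N) => @curve_integrand _ _ _ lam x m0 l0 xS f p i fp).
rewrite Lambda0 Lambda1// => iF EF; split => //.
rewrite (design_meridian des x_inj X_x (fun i : 'I_(2 * N) => ~~ odd i) pt fp).
rewrite /F EFin_Rintegral// EF; congr EFin; apply: eq_bigr => i _.
rewrite /G RintegralZl//; last by apply: continuous_integrable; exact: cM.
(* The Jacobian width / pi of the passage to the angle cancels the speed [rate] = pi / width,
   leaving the term of [design_meridian]. *)
rewrite (Rintegral_affine (Llt i) (@continuous_meridian _ _ p (~~ odd i) (x i))).
have wi := width_gt0 m0 l0 i; have pi0 := pi_gt0 R.
rewrite /C /rate -/(width lam x i).
set I := (X in _ = _ * (_ * X)).
transitivity (lam (x i) * volume_ratio R n.+2 * (pi / width lam x i) *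
  (width lam x i / pi * I)); first by [].
move: (width lam x i) wi I => w w0 I; move: (pi : R) pi0 => q q0; field.
by rewrite !gt_eqF.
Qed.
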